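(* Assume $T=\mathrm{poly}(m)$, where $T$ is the time horizon of the linear program (P) defined in the context. Let $(x,y,z)$ be an optimal solution to (P) and let $\mathrm{OPT}$ be its objective value. Then Algorithm 1 (described in full in the context), run on $(x,y,z)$, succeeds with probability $1-1/\mathrm{poly}(m)$, and returns a solution to the MLUFL instance of expected cost (conditioned on success) $$O\bigl(\log n\cdot\max\{\log n,\log m\}\bigr)\cdot\mathrm{OPT}.$$
   Context: **MLUFL** (minimum-latency uncapacitated facility location). The input is a set $\mathcal F$ of $n$ facilities with opening costs $f_i$, a set $\mathcal D$ of $m$ clients, connection costs $c_{ij}$ for $i\in\mathcal F$, $j\in\mathcal D$ (not necessarily a metric), a root $r$, and an integer-valued metric $d$ on $\mathcal F\cup\{r\}$ (the time metric). A feasible solution is a set $F\subseteq\mathcal F$ of open facilities, a path $P$ starting at $r$ and spanning $F$, and an assignment $\phi:\mathcal D\to F$. Its cost is $\sum_{i\in F}f_i+\sum_{j\in\mathcal D}(c_{\phi(j)j}+t_j)$, where $t_j=d_P(r,\phi(j))$ (the latency of $j$) is the time taken to reach $\phi(j)$ along $P$. **The LP (P).** Let $E$ be the edge set of the complete graph on $\mathcal F\cup\{r\}$, $d_{\max}=\max_{e\in E}d_e$, and let $T\le\min\{n,m\}d_{\max}$ be a known upper bound on the maximum activation time of an open facility in an optimal solution. For $S\subseteq\mathcal F$, $\delta(S)$ is the set of edges of $E$ with exactly one end in $S$. With $i\in\mathcal F$, $j\in\mathcal D$, $e\in E$, $t\in\{1,\dots,T\}$, (P) is: minimize $\sum_{i,t}f_iy_{i,t}+\sum_{j,i,t}(c_{ij}+t)x_{ij,t}$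 subject to $\sum_{i,t}x_{ij,t}\ge1$ for all $j$; $x_{ij,t}\le y_{i,t}$ for all $i,j,t$; $\sum_ed_ez_{e,t}\le t$ for all $t$; $\sum_{e\in\delta(S)}z_{e,t}\ge\sum_{i\in S,\,t'\le t}x_{ij,t'}$ for all $t$, $S\subseteq\mathcal F$, $j$; $x,y,z\ge0$; and $y_{i,t}=0$ whenever $d_{ir}>t$. **Two known subroutines.** *Tree embedding*: given edge weights $\{w_e\}_{e\in E}$, one can deterministically construct a weighted tree $\mathcal T$ with leaf set $\mathcal F\cup\{r\}$ whose tree metric $d_{\mathcal T}$ satisfies $d_{\mathcal T}(i,i')\ge d_{ii'}$ for all $i,i'\in\mathcal F\cup\{r\}$ and $\sum_{(i,i')\in E}d_{\mathcal T}(i,i')w_{ii'}=O(\log n)\sum_ed_ew_e$. *GKR algorithm* (Garg–Konjevod–Ravi): given a tree $\mathcal T$ rooted at $r$ with $n$ leaves, groups $G_1,\dots,G_p$ of leaves, and values $w_e$ on the edges of $\mathcal T$ such that $w(\delta(S))\ge\nu_j$ for every group $G_j$ and every node set $S\supseteq G_j$ with $r\notin S$, where $\nu_j\in[\frac12,1]$, this randomized polynomial-time algorithm returns a subtree $T''$ of $\mathcal T$ rooted at $r$ with $\Pr[e\in T'']\le w_e$ for every edge $e$ and $\Pr[T''\cap G_j=\emptyset]\le\exp\bigl(-\frac{\nu_j}{64\log_2n}\bigr)$ for every $j$. **Algorithm 1.** Input: the solution $(x,y,z)$ of (P). For each client $j$ let $C^*_j=\sum_{i,t}c_{ij}x_{ij,t}$,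 $N_j=\{i\in\mathcal F:c_{ij}\le4C^*_j\}$, and let $\tau_j$ be the earliest time $t$ with $\sum_{i\in N_j,\,t'\le t}x_{ij,t'}\ge\frac23$. Let $\tau_{\max}=\max_j\tau_j$. A1. For each phase $\ell=0,1,\dots,\mathcal N:=\lceil\log_2(2\tau_{\max})+4\log_2m\rceil$, let $t_\ell=\min\{2^\ell,T\}$ and do the following. A1.1. Apply the tree embedding with edge weights $\{z_{e,t_\ell}\}$ to get a tree $\mathcal T_\ell$ with edge set $E(\mathcal T_\ell)$. Extend it to a tree $\mathcal T'_\ell$ by adding, for each facility $i$, a dummy leaf edge $(i,v_i)$ of cost $f_i$. Let $E'=\{(i,v_i):i\in\mathcal F\}$. A1.2. Define $w$ on the edges of $\mathcal T'_\ell$: for $e\in E(\mathcal T_\ell)$, $w_e=\sum z_{ii',t_\ell}$ over all pairs $(i,i')\in E$ such that $e$ lies on the unique $i$–$i'$ path in $\mathcal T_\ell$; for $e=(i,v_i)\in E'$, $w_e=\sum_{t\le t_\ell}y_{i,t}$. A1.3. Let $D_\ell=\{j:\tau_j\le t_\ell\}$ and, for $j\in D_\ell$, define the group $N'_j=\{v_i:i\in N_j\}$. Obtain $N:=\log_2m$ subtrees $T''_1,\dots,T''_N$ of $\mathcal T'_\ell$, where each $T''_q$ is the union of the subtrees returned by $192\log_2n$ executions of the GKR algorithm on $\mathcal T'_\ell$ with values $w$ and groups $\{N'_j\}_{j\in D_\ell}$ (one may assume $i\in T''_q$ iff $(i,v_i)\in T''_q$). Let $T'_\ell$ be any of these trees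 satisfying both (i) $\sum_{(i,v_i)\in E(T'_\ell)}f_i\le40\cdot192\log_2n\sum_{(i,v_i)\in E'}f_iw_{(i,v_i)}$ and (ii) $\sum_{e\in E(T'_\ell)\setminus E'}d_{\mathcal T_\ell}(e)\le40\cdot192\log_2n\sum_{e\in E(\mathcal T_\ell)}d_{\mathcal T_\ell}(e)w_e$. If no such tree exists, the algorithm fails. A1.4. Remove all dummy edges from $T'_\ell$, open all the facilities in the resulting tree, and convert this tree into a tour $\mathrm{Tour}_\ell$ traversing all the opened facilities (double all edges, take an Eulerian tour, shortcut). Connect every not-yet-connected client $j$ to a facility in $N_j$ if some such facility is open (and hence part of $\mathrm{Tour}_\ell$). A2. Return the concatenation of the tours $\mathrm{Tour}_\ell$ for $\ell=0,1,\dots,\mathcal N$, shortcutting whenever possible; this induces an ordering of the open facilities. If some client is left unconnected, the algorithm has failed. The algorithm *succeeds* if it does not fail in A1.3 or A2.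
   Formalization: ''Any of these trees'' in A1.3 is read as a choice depending only on the phase and on which indices q satisfy (i) and (ii), since a choice that sees the clients covered can make the algorithm fail; n, m ≥ 2 is assumed, and the numbers of trees, executions and phases are rounded up. *)

(* Defs.v *)
From HB Require Import structures.
From mathcomp Require Import all_boot all_order all_algebra.
From mathcomp Require Import boolp reals sequences exp.

Set Implicit Arguments.
Unset Strict Implicit.
Unset Printing Implicit Defensive.

Import Order.TTheory GRing.Theory Num.Theory.
Local Open Scope ring_scope.

Definition log2 {R : realType} (a : R) : R := ln a / ln 2.

Definition ceil_nat {R : realType} (a : R) : nat := `|Num.ceil a|%N.

(* [undup] alone keeps the last occurrence of each item. *)
Definition first_occ {A : eqType} (s : seq A) : seq A := rev (undup (rev s)).

(** * Finite probability distributions *)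

Section Distributions.
Variable R : realType.

Record fdist (A : finType) := FDist {
  pmf :> {ffun A -> R};
  pmf_ge0 : forall a, 0 <= pmf a;
  pmf_sum1 : \sum_a pmf a = 1 }.

Definition Pr (A : finType) (P : fdist A) (E : pred A) : R :=
  \sum_(a | E a) P a.

Definition cond_expect (A : finType) (P : fdist A) (E : pred A) (X : A -> R) : R :=
  (\sum_(a | E a) P a * X a) / Pr P E.

Section Product.
Variables (K : finType) (A : K -> finType) (P : forall k, fdist (A k)).

Definition prod_pmf : {ffun fprod A -> R} := [ffun s : fprod A => \prod_k P k (s k)].

Lemma prod_pmf_ge0 s : 0 <= prod_pmf s.
Proof. by rewrite ffunE; apply: prodr_ge0 => k _; exact: pmf_ge0. Qed.

Lemma prod_pmf_sum1 : \sum_s prod_pmf s = 1.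
Proof.
under eq_bigr do rewrite ffunE.
rewrite (@big_fprod _ _ _ _ +%R _ _ (fun k => pmf (P k))) /=.
rewrite -(bigA_distr_big_dep _ (fun k => untag 0 (pmf (P k)))) /=.
by apply: big1 => k _; rewrite -(big_tag (fun k => pmf (P k))) pmf_sum1.
Qed.

(* The joint law of independent draws, one from each [P k]. *)
Definition fdist_prod : fdist (fprod A) := FDist prod_pmf_ge0 prod_pmf_sum1.

End Product.
End Distributions.

(** * The MLUFL problem *)

(* The vertices of the complete graph on the facilities and the root are
   ['I_n.+1]: the root is [ord0] and facility [i] is [fac i]. *)
Definition fac {n : nat} (i : 'I_n) : 'I_n.+1 := lift ord0 i.

(* The undirected edge between [u] and [v] is the pair [(u, v)] with [u < v]. *)
Definition edge (n : nat) : finType := ('I_n.+1 * 'I_n.+1)%type.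

Definition is_edge {n : nat} (e : edge n) : bool := (e.1 < e.2)%N.

Record mlufl (R : realType) (n m : nat) := MLUFL {
  fcost : 'I_n -> R;
  ccost : 'I_n -> 'I_m -> R;
  time : 'I_n.+1 -> 'I_n.+1 -> nat;
  fcost_ge0 : forall i, 0 <= fcost i;
  ccost_ge0 : forall i j, 0 <= ccost i j;
  time_eq0 : forall u v, time u v = 0%N <-> u = v;
  time_sym : forall u v, time u v = time v u;
  time_triangle : forall u v w, (time u w <= time u v + time v w)%N }.

Definition time_max {R : realType} {n m : nat} (I : mlufl R n m) : nat :=
  \max_(e : edge n | is_edge e) time I e.1 e.2.

(* The path starts at the root and then visits the facilities of [route] in
   order. *)
Record solution (n m : nat) := Solution {
  opened : {set 'I_n};
  route : seq 'I_n;
  assigned : 'I_m -> 'I_n }.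

Section Solutions.
Variables (R : realType) (n m : nat) (I : mlufl R n m).

Definition feasible (s : solution n m) : Prop :=
  [/\ uniq (route s), route s =i opened s & forall j, assigned s j \in opened s].

Definition walk_time (u : 'I_n.+1) (p : seq 'I_n.+1) : nat :=
  \sum_(e <- zip (u :: p) p) time I e.1 e.2.

Definition activation (s : solution n m) (i : 'I_n) : nat :=
  walk_time ord0 (map fac (take (index i (route s)).+1 (route s))).

Definition cost (s : solution n m) : R :=
  \sum_(i in opened s) fcost I i
  + \sum_j (ccost I (assigned s j) j + (activation s (assigned s j))%:R).

Definition optimal (s : solution n m) : Prop :=
  feasible s /\ forall s', feasible s' -> cost s <= cost s'.

(* [T] is at most min(n, m) d_max and bounds the activation times of the open
   facilities of some optimal solution. *)
Definition horizon (T : nat) : Prop :=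
  (T <= minn n m * time_max I)%N /\
  exists s, optimal s /\ forall i, i \in opened s -> (activation s i <= T)%N.

End Solutions.

(** * The linear program *)

(* Only the values at times 1, ..., T are relevant. *)
Record lp_point (R : realType) (n m : nat) := LPPoint {
  xvar : 'I_n -> 'I_m -> nat -> R;
  yvar : 'I_n -> nat -> R;
  zvar : edge n -> nat -> R }.

Definition delta {n : nat} (S : {set 'I_n}) : {set edge n} :=
  [set e | is_edge e & (e.1 \in fac @: S) != (e.2 \in fac @: S)].

Section LP.
Variables (R : realType) (n m : nat) (I : mlufl R n m) (T : nat).

Definition lp_objective (s : lp_point R n m) : R :=
  \sum_i \sum_(1 <= t < T.+1) fcost I i * yvar s i t
  + \sum_j \sum_i \sum_(1 <= t < T.+1) (ccost I i j + t%:R) * xvar s i j t.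

Definition lp_feasible (s : lp_point R n m) : Prop :=
  (forall j, 1 <= \sum_i \sum_(1 <= t < T.+1) xvar s i j t) /\
  forall t, (1 <= t <= T)%N ->
  (forall i j, xvar s i j t <= yvar s i t) /\
  (\sum_(e | is_edge e) (time I e.1 e.2)%:R * zvar s e t <= t%:R) /\
  (forall (S : {set 'I_n}) j,
    \sum_(i in S) \sum_(1 <= t' < t.+1) xvar s i j t' <= \sum_(e in delta S) zvar s e t) /\
  (forall i j, 0 <= xvar s i j t) /\
  (forall i, 0 <= yvar s i t) /\
  (forall e, is_edge e -> 0 <= zvar s e t) /\
  (forall i, (t < time I (fac i) ord0)%N -> yvar s i t = 0).

Definition lp_optimal (s : lp_point R n m) : Prop :=
  lp_feasible s /\ forall s', lp_feasible s' -> lp_objective s <= lp_objective s'.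

End LP.

(** * Rooted trees *)

(* The edges of a rooted tree correspond to its nodes other than [top]: node
   [v] stands for the edge between [v] and [parent v]. *)
Record rtree := RTree {
  node :> finType;
  top : node;
  parent : node -> node;
  parent_top : parent top = top;
  reach_top : forall v, exists k, iter k parent v = top }.

Section Trees.
Variable T : rtree.

Definition adj (u v : T) : bool :=
  (u != v) && ((parent u == v) || (parent v == u)).

Definition leaves : {set T} := [set v | #|[set u | adj v u]| == 1%N].

(* Number of steps along edge [v], in either direction, of the walk [x :: p]. *)
Definition traversals (v x : T) (p : seq T) : nat :=
  count (fun s => (s == (v, parent v)) || (s == (parent v, v))) (zip (x :: p) p).

(* Edge [v] lies on the simple path between [x] and [y]. *)
Definition on_path (x y v : T) : bool :=
  `[< exists p, [/\ path adj x p, last x p = y, uniq (x :: p)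
                  & (0 < traversals v x p)%N] >].

(* Node sets of the subtrees containing [top]; the edges of such a subtree are
   the [v \in A] with [v != top]. *)
Definition subtree (A : {set T}) : Prop :=
  top T \in A /\ forall v, v \in A -> parent v \in A.

(* [p] is an Eulerian tour from [top] of the subtree [A] with doubled edges. *)
Definition euler_tour (A : {set T}) (p : seq T) : Prop :=
  [/\ path adj (top T) p, last (top T) p = top T
    & forall v, v != top T -> traversals v (top T) p = (2 * (v \in A))%N].

End Trees.

(* [lab] places the facilities and the root among the nodes. *)
Record etree (R : realType) (n : nat) := ETree {
  shape :> rtree;
  len : shape -> R;
  lab : 'I_n.+1 -> shape }.

Definition tree_dist {R : realType} {n : nat} (T : etree R n) (u v : 'I_n.+1) : R :=
  \sum_(a | a != top T) (on_path (lab T u) (lab T v) a)%:R * len a.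

(** * Extending a tree by a dummy leaf edge (i, v_i) below each facility i *)

Section Extension.
Variables (R : realType) (n : nat) (T : etree R n).

Definition ext_parent (v : T + 'I_n) : T + 'I_n :=
  match v with
  | inl u => inl (parent u)
  | inr i => inl (lab T (fac i))
  end.

Lemma ext_parent_top : ext_parent (inl (top T)) = inl (top T).
Proof. by rewrite /= parent_top. Qed.

Lemma ext_reach_top v : exists k, iter k ext_parent v = inl (top T).
Proof.
have up u : exists k, iter k ext_parent (inl u) = inl (top T).
  have [k <-] := reach_top u; exists k.
  by elim: k => //= k ->.
case: v => [u|i]; first exact: up.
by have [k <-] := up (lab T (fac i)); exists k.+1; rewrite iterSr.
Qed.

Definition ext : rtree := RTree ext_parent_top ext_reach_top.

End Extension.

(** * The two subroutines *)

Section Subroutines.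
Variables (R : realType) (n m : nat) (I : mlufl R n m).

Definition tree_embedding_spec (alpha : R) (embed : (edge n -> R) -> etree R n) : Prop :=
  forall w : edge n -> R, (forall e, is_edge e -> 0 <= w e) ->
  let T := embed w in
  injective (lab T) /\
  lab T ord0 = top T /\
  leaves T = [set lab T u | u : 'I_n.+1] /\
  (forall a, 0 <= len (e := T) a) /\
  (forall u v, (time I u v)%:R <= tree_dist T u v) /\
  \sum_(e | is_edge e) tree_dist T e.1 e.2 * w e
    <= alpha * log2 n%:R * \sum_(e | is_edge e) (time I e.1 e.2)%:R * w e.

End Subroutines.

Definition gkr_algorithm (R : realType) :=
  forall T : rtree, {set {set T}} -> (T -> R) -> fdist R {set T}.

(* The root does not count as a leaf of a rooted tree. *)
Definition gkr_spec {R : realType} (gkr : gkr_algorithm R) : Prop :=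
  forall (T : rtree) (groups : {set {set T}}) (w : T -> R) (nu : {set T} -> R),
  let L := leaves T :\ top T in
  (forall v, v != top T -> 0 <= w v) ->
  (forall G, G \in groups -> G \subset L) ->
  (forall G, G \in groups -> 1 / 2 <= nu G <= 1) ->
  (forall G (S : {set T}), G \in groups -> G \subset S -> top T \notin S ->
    nu G <= \sum_(v | (v != top T) && ((v \in S) != (parent v \in S))) w v) ->
  let P := gkr T groups w in
  [/\ forall A, 0 < P A -> subtree A,
      forall v, v != top T -> Pr P (fun A => v \in A) <= w v
    & forall G, G \in groups ->
        Pr P (fun A => A :&: G == set0) <= expR (- (nu G / (64 * log2 #|L|%:R)))].

(** * Algorithm 1 *)

(* Number of trees drawn in a phase, and of GKR executions per tree. *)
Definition num_trees (R : realType) (m : nat) : nat := ceil_nat (log2 (m%:R : R)).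
Definition num_runs (R : realType) (n : nat) : nat := ceil_nat (192 * log2 (n%:R : R)).

(* What the algorithm calls or leaves unspecified:
   - [select l Q] is the tree used in phase [l] when [Q] is the set of the
     indices of the trees with properties (i) and (ii);
   - [tour T A] is an Eulerian tour of the doubled subtree [A];
   - [connect l j S] is the facility of [S] to which [j] gets connected in
     phase [l] when [S] is the set of the facilities of N_j in Tour_l.
   [select] sees nothing of the trees beyond [Q]: if it could look at the groups
   that they cover, it could prefer trees that miss a given client. *)
Record choices (R : realType) (n m : nat) := Choices {
  embed : (edge n -> R) -> etree R n;
  gkr : gkr_algorithm R;
  select : nat -> {set 'I_(num_trees R m)} -> 'I_(num_trees R m);
  tour : forall T : rtree, {set T} -> seq T;
  connect_to : nat -> 'I_m -> {set 'I_n} -> 'I_n }.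

Definition choices_spec {R : realType} {n m : nat} (I : mlufl R n m) (alpha : R)
    (C : choices R n m) : Prop :=
  [/\ tree_embedding_spec I alpha (embed C),
      gkr_spec (gkr C),
      forall l Q, Q != set0 -> select C l Q \in Q,
      forall (T : rtree) (A : {set T}), subtree A -> euler_tour A (tour C A)
    & forall l j S, S != set0 -> connect_to C l j S \in S].

Section Algorithm.
Variables (R : realType) (n m : nat) (I : mlufl R n m) (T : nat).
Variables (s : lp_point R n m) (C : choices R n m).

Definition Cstar (j : 'I_m) : R :=
  \sum_i \sum_(1 <= t < T.+1) ccost I i j * xvar s i j t.

Definition near (j : 'I_m) : {set 'I_n} := [set i | ccost I i j <= 4 * Cstar j].

(* The value is [T.+1] when there is no such time. *)
Definition tau (j : 'I_m) : nat :=
  find (fun t => 2 / 3 <= \sum_(i in near j) \sum_(1 <= t' < t.+1) xvar s i j t')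
    (iota 0 T.+1).

Definition tau_max : nat := \max_j tau j.

Definition last_phase : nat :=
  ceil_nat (log2 (2 * tau_max%:R) + 4 * log2 m%:R : R).

Section Phase.
Variable l : nat.

Definition phase_time : nat := minn (2 ^ l) T.

Definition tree : etree R n := embed C (fun e => zvar s e phase_time).

Definition weight (v : ext tree) : R :=
  match v with
  | inl a => \sum_(e | is_edge e && on_path (lab tree e.1) (lab tree e.2) a)
               zvar s e phase_time
  | inr i => \sum_(1 <= t < phase_time.+1) yvar s i t
  end.

Definition group (j : 'I_m) : {set ext tree} := [set inr i | i in near j].

Definition groups : {set {set ext tree}} :=
  [set group j | j : 'I_m & (tau j <= phase_time)%N].

Definition gkr_law : fdist R {set ext tree} := gkr C groups weight.

(* Dropping each facility [i] reached by [A] when [v_i] is not: [i] is a leaf of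
   the embedding tree, so what remains is a subtree containing [i] iff it
   contains [v_i]. *)
Definition prune (A : {set ext tree}) : {set ext tree} :=
  A :\: [set inl (lab tree (fac i)) | i : 'I_n & inr i \notin A].

Definition cheap (A : {set ext tree}) : bool :=
  (\sum_(i | inr i \in A) fcost I i
     <= 40 * (192 * log2 n%:R) * \sum_i fcost I i * weight (inr i)) &&
  (\sum_(a | (a != top tree) && (inl a \in A)) len a
     <= 40 * (192 * log2 n%:R) * \sum_(a | a != top tree) len a * weight (inl a)).

End Phase.

(* A run [(l, q, k)] is the [k]-th GKR execution for the [q]-th tree of phase
   [l]; all the executions are independent. *)
Definition run : finType :=
  ('I_last_phase.+1 * 'I_(num_trees R m) * 'I_(num_runs R n))%type.

Definition run_space (r : run) : finType := {set ext (tree r.1.1)}.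

Definition outcome : finType := fprod run_space.

Definition law : fdist R outcome :=
  fdist_prod (fun r : run => gkr_law r.1.1 : fdist R (run_space r)).

Section Execution.
Variable w : outcome.

Definition drawn_tree (l : 'I_last_phase.+1) (q : 'I_(num_trees R m)) :
    {set ext (tree l)} :=
  prune (\bigcup_k (w (l, q, k) : {set ext (tree l)})).

Definition good_trees (l : 'I_last_phase.+1) : {set 'I_(num_trees R m)} :=
  [set q | cheap (drawn_tree l q)].

(* The chosen tree of phase [l] without its dummy edges. *)
Definition phase_tree (l : 'I_last_phase.+1) : {set tree l} :=
  [set a | inl a \in drawn_tree l (select C l (good_trees l))].

Definition phase_opened (l : 'I_last_phase.+1) : {set 'I_n} :=
  [set i | lab (tree l) (fac i) \in phase_tree l].

Definition phase_tour (l : 'I_last_phase.+1) : seq 'I_n :=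
  first_occ (pmap (fun a => [pick i | lab (tree l) (fac i) == a])
                  (tour C (phase_tree l))).

Definition connectable (j : 'I_m) (l : 'I_last_phase.+1) : bool :=
  near j :&: phase_opened l != set0.

(* The phase in which [j] gets connected; if there is none, then the algorithm
   fails and the default value is irrelevant. *)
Definition connection_phase (j : 'I_m) : 'I_last_phase.+1 :=
  head ord0 (filter (connectable j) (enum 'I_last_phase.+1)).

Definition success : bool :=
  [forall l, good_trees l != set0] && [forall j, exists l, connectable j l].

Definition output : solution n m :=
  Solution (\bigcup_l phase_opened l)
    (first_occ (flatten [seq phase_tour l | l <- enum 'I_last_phase.+1]))
    (fun j => let l := connection_phase j in
              connect_to C l j (near j :&: phase_opened l)).

End Execution.
End Algorithm.

(* Main.v *)
Require Import Defs.
From mathcomp Require Import all_boot all_order all_algebra.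
From mathcomp Require Import boolp reals sequences exp.
From mathcomp Require Import ring lra zify.

(** In a phase whose time is at least [tau j], the values [w] cross every cut
    around the group of [j] by at least 2/3, so the union of the GKR runs misses
    the group with probability at most e^-2 < 15/64, while by Markov's inequality
    it is cheap with probability at least 15/16. The trees of a phase are
    independent and the tree kept is selected from the goodness pattern alone, so
    given that the phase does not fail, [j] is missed with probability at most
    1/4. The phases are independent as well: given that no phase fails, the phase
    in which [j] gets connected has a tail with ratio 1/4, which beats the
    doubling of the tour lengths and makes the expected latency of [j] at most
    O(log^2 n) [tau j]; and [tau j] is at most 12 times the latency of [j] in the
    linear program. No phase fails except with probability O(log m) m^-4. *)

Set Implicit Arguments.
Unset Strict Implicit.
Unset Printing Implicit Defensive.

Import Order.TTheory GRing.Theory Num.Theory.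
Local Open Scope ring_scope.

(** * Expectation and independence *)

(** Success also demands that every client gets connected, and this part of the event does not
    factor over the phases, so conditioning on success directly would spoil the independence. The
    estimates are therefore made on [all_good], the event that no phase fails, and are kept
    multiplicative in its probability. Success is contained in [all_good] and has at least half of
    its probability, so changing the condition costs a factor 2.

    On success little randomness remains in the cost bound. The tests (i) and (ii) bound openings
    and tour lengths in every such outcome, and connection costs are at most [4 * Cstar j] by the
    choice of [near]; only the phase in which a client gets connected has to be averaged.

    The two terms of the maximum have different origins: openings pay the GKR factor log n once in
    each of O(log m) phases, while latencies pay log n for the GKR runs and log n for the tree
    embedding. *)

Section Expectation.
Variables (R : realType) (A : finType) (P : fdist R A).

Definition expect (X : A -> R) : R := \sum_a P a * X a.

Lemma Pr_expect (E : pred A) : Pr P E = expect (fun a => (E a)%:R).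
Proof.
rewrite /Pr /expect big_mkcond; apply: eq_bigr => a _.
by case: (E a); rewrite ?mulr1 ?mulr0.
Qed.

Lemma expectZ c X : expect (fun a => c * X a) = c * expect X.
Proof. by rewrite mulr_sumr; apply: eq_bigr => a _; rewrite mulrCA. Qed.

Lemma expect_sum (I : Type) (r : seq I) (Q : pred I) (X : I -> A -> R) :
  expect (fun a => \sum_(i <- r | Q i) X i a) = \sum_(i <- r | Q i) expect (X i).
Proof. by rewrite exchange_big; apply: eq_bigr => a _; rewrite mulr_sumr. Qed.

Lemma ler_expect X Y :
  (forall a, 0 < P a -> X a <= Y a) -> expect X <= expect Y.
Proof.
move=> le_XY; apply: ler_sum => a _.
have := pmf_ge0 P a; rewrite le_eqVlt => /predU1P[<-|Pa]; first by rewrite !mul0r.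
by rewrite ler_pM2l// le_XY.
Qed.

Lemma eq_expect X Y : X =1 Y -> expect X = expect Y.
Proof. by move=> eqXY; apply: eq_bigr => a _; rewrite eqXY. Qed.

Lemma expect_ge0 X : (forall a, 0 <= X a) -> 0 <= expect X.
Proof. by move=> X0; apply: sumr_ge0 => a _; rewrite mulr_ge0// pmf_ge0. Qed.

Lemma expect_cst c : expect (fun=> c) = c.
Proof. by rewrite /expect -mulr_suml pmf_sum1 mul1r. Qed.

Lemma expect_add X Y : expect (fun a => X a + Y a) = expect X + expect Y.
Proof. by rewrite -big_split; apply: eq_bigr => a _; rewrite mulrDr. Qed.

Lemma PrC (E : pred A) : Pr P (predC E) = 1 - Pr P E.
Proof. by rewrite /Pr -(pmf_sum1 P) [in RHS](bigID E)/= addrC addrK. Qed.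

Lemma ler_Pr (E F : pred A) :
  (forall a, 0 < P a -> E a -> F a) -> Pr P E <= Pr P F.
Proof.
move=> sEF; rewrite !Pr_expect; apply: ler_expect => a /sEF.
by case: (E a); case: (F a) => //= /(_ isT).
Qed.

Lemma Pr_or (E F : pred A) : Pr P (predU E F) <= Pr P E + Pr P F.
Proof.
rewrite !Pr_expect -expect_add; apply: ler_expect => a _ /=.
by case: (E a); case: (F a) => /=; lra.
Qed.

(** A budget [C] may vanish, for instance when facilities are free. Then the expectation is 0, which
    forces [X] to be 0 on the support. *)
Lemma markov (X : A -> R) (p C : R) : (forall a, 0 <= X a) -> 0 <= p -> 0 <= C ->
  expect X <= p * C -> Pr P (fun a => C < X a) <= p.
Proof.
move=> X0 p0; rewrite le_eqVlt => /predU1P[<-|C0] EX.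
  have EX0 : expect X = 0.
    by apply/eqP; rewrite eq_le expect_ge0// andbT (le_trans EX)// mulr0.
  rewrite /Pr big1// => a Xa.
  have /eqP := psumr_eq0P (fun a _ => mulr_ge0 (pmf_ge0 P a) (X0 a)) EX0 (i := a) isT.
  by rewrite mulf_eq0 => /orP[/eqP //|/eqP Xa0]; rewrite Xa0 ltxx in Xa.
rewrite -(ler_pM2l C0) [leRHS]mulrC (le_trans _ EX)// Pr_expect -expectZ.
apply: ler_expect => a _.
by case: ltP => [/ltW|_]; rewrite ?mulr1 ?mulr0.
Qed.

End Expectation.

(** * Product laws *)

Section Independence.
Variables (R : realType) (K : finType) (A : K -> finType).
Variable P : forall k, fdist R (A k).

Local Notation Pi := (fdist_prod P).

Lemma sum_fprod (h : forall k, A k -> R) :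
  \sum_(s : fprod A) \prod_k h k (s k) = \prod_k \sum_a h k a.
Proof.
pose g k : {ffun A k -> R} := [ffun a => h k a].
transitivity (\sum_(s : fprod A) \prod_k g k (s k)).
  by apply: eq_bigr => s _; apply: eq_bigr => k _; rewrite ffunE.
rewrite (@big_fprod _ _ _ _ +%R _ _ g) /=.
rewrite -(bigA_distr_big_dep _ (fun k => untag 0 (g k))) /=.
apply: eq_bigr => k _; rewrite -(big_tag g).
by apply: eq_bigr => a _; rewrite ffunE.
Qed.

Lemma expect_prod (h : forall k, A k -> R) :
  expect Pi (fun s => \prod_k h k (s k)) = \prod_k expect (P k) (h k).
Proof.
rewrite /expect -(sum_fprod (fun k a => P k a * h k a)).
by apply: eq_bigr => s _; rewrite ffunE big_split.
Qed.

Lemma expect_coord (h : forall k, A k -> R) k :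
  expect Pi (fun s => h k (s k)) = expect (P k) (h k).
Proof.
pose g k' := if k' == k then h k' else fun=> 1.
have -> : expect Pi (fun s => h k (s k)) = expect Pi (fun s => \prod_k' g k' (s k')).
  apply: eq_expect => s; rewrite (bigD1 k)//= /g eqxx big1 ?mulr1// => k'.
  by move/negPf->.
rewrite expect_prod (bigD1 k)//= {1}/g eqxx big1 ?mulr1// => k' /negPf k'k.
by rewrite /g k'k expect_cst.
Qed.

Lemma pmf_coord (s : fprod A) k : 0 < Pi s -> 0 < P k (s k).
Proof.
rewrite /= ffunE => Ps; rewrite lt0r pmf_ge0 andbT.
by apply: contraTneq Ps => P0; rewrite (bigD1 k)//= P0 mul0r ltxx.
Qed.

Definition depends_on (S : pred K) (T : Type) (f : fprod A -> T) : Prop :=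
  forall s s' : fprod A, (forall k, S k -> s k = s' k) -> f s = f s'.

Definition merge (S : pred K) (s s' : fprod A) : fprod A :=
  [fprod k : K => if S k then s k else s' k].

(* Exchanging the coordinates outside [S] of two independent outcomes preserves
   their joint law. *)
Lemma expect_indep (S S' : pred K) (f g : fprod A -> R) :
  depends_on S f -> depends_on S' g -> (forall k, S k -> ~~ S' k) ->
  expect Pi (fun s => f s * g s) = expect Pi f * expect Pi g.
Proof.
move=> dep_f dep_g disj.
pose sw (u : fprod A * fprod A) := (merge S u.1 u.2, merge S u.2 u.1).
have swK : involutive sw.
  have mergeK s s' : merge S (merge S s s') (merge S s' s) = s.
    by apply/fprodP => k; rewrite /merge !fprodE; case: (S k).
  by move=> [s s']; rewrite /sw /= !mergeK.
rewrite /expect big_distrlr/= pair_big/= (reindex_inj (inv_inj swK))/=.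
transitivity (\sum_(u : fprod A * fprod A) (Pi u.1 * Pi u.2) * (f u.1 * g u.1)).
  rewrite -(pair_big predT predT (fun s s' => (Pi s * Pi s') * (f s * g s)))/=.
  apply: eq_bigr => s _; rewrite -mulr_suml -mulr_sumr.
  by rewrite prod_pmf_sum1 mulr1.
apply: eq_bigr => -[s s'] _ /=.
have -> : f (merge S s s') = f s by apply: dep_f => k Sk; rewrite fprodE Sk.
have -> : g (merge S s' s) = g s.
  apply: dep_g => k S'k; rewrite fprodE; case: ifP => // Sk.
  by have := disj _ Sk; rewrite S'k.
have <- : Pi (merge S s s') * Pi (merge S s' s) = Pi s * Pi s'.
  rewrite /= !ffunE -!big_split; apply: eq_bigr => k _ /=.
  by rewrite !fprodE; case: ifP => // _; rewrite mulrC.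
by rewrite mulrACA.
Qed.

(** The factors after the first depend jointly on the union of their coordinate sets, which is
    disjoint from that of the first, so the case of two factors can be iterated. *)
Lemma expect_indep_prod (I : finType) (B : {pred I}) (S : I -> pred K)
    (f : I -> fprod A -> R) :
  (forall i, depends_on (S i) (f i)) ->
  (forall i j k, S i k -> S j k -> i = j) ->
  expect Pi (fun s => \prod_(i in B) f i s) = \prod_(i in B) expect Pi (f i).
Proof.
move=> dep_f disj; rewrite -!big_enum; have := enum_uniq B.
under eq_expect do rewrite -big_enum.
elim: (enum B) => [|i r IHr] /=.
  by rewrite big_nil; under eq_expect do rewrite big_nil; rewrite expect_cst.
case/andP=> ir /IHr E; rewrite big_cons -{}E.
under eq_expect do rewrite big_cons.
apply: (expect_indep (S := S i) (S' := fun k => has (fun j => S j k) r)) => //.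
  move=> s s' eq_s; rewrite !big_seq; apply: eq_bigr => j jr.
  by apply: dep_f => k Sk; apply: eq_s; apply/hasP; exists j.
move=> k Si; apply/hasPn => j jr; apply: contra ir => Sj.
by rewrite (disj _ _ _ Si Sj).
Qed.

End Independence.

(* Conditioned on which trials are good, the trials remain independent, so one
   selected among the good ones from this information alone is still a typical
   good trial. *)
Section Selection.
Variables (R : realType) (K : finType) (A : K -> finType).
Variable P : forall k, fdist R (A k).
Variables (I : finType) (S : I -> pred K).
Variables (good miss : I -> fprod A -> bool).
Hypothesis dep_good : forall i, depends_on (S i) (good i).
Hypothesis dep_miss : forall i, depends_on (S i) (miss i).
Hypothesis disj : forall i j k, S i k -> S j k -> i = j.
Variables (sel : {set I} -> I) (rho : R).
Hypothesis selP : forall Q, Q != set0 -> sel Q \in Q.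
Local Notation Pi := (fdist_prod P).
Hypothesis good_miss : forall i,
  expect Pi (fun s => (good i s && miss i s)%:R)
    <= rho * expect Pi (fun s => (good i s)%:R).

Let Good s := [set i | good i s].

Lemma selection : expect Pi (fun s => ((Good s != set0) && miss (sel (Good s)) s)%:R)
  <= rho * expect Pi (fun s => (Good s != set0)%:R).
Proof.
(* Fixing the goodness pattern [Q] turns the selected index into a constant. *)
have split_Good (h : {set I} -> fprod A -> bool) s :
    ((Good s != set0) && h (Good s) s)%:R
    = \sum_(Q | Q != set0) ((Good s == Q) && h Q s)%:R :> R.
  have [G0|G0] := boolP (Good s != set0).
    rewrite (bigD1 (Good s))//= eqxx big1 ?addr0// => Q /andP[_].
    by rewrite eq_sym => /negPf ->.
  rewrite big1// => Q Q0; case: eqP => // GQ.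
  by rewrite GQ Q0 in G0.
under eq_expect do rewrite (split_Good (fun Q => miss (sel Q))).
have -> : expect Pi (fun s => (Good s != set0)%:R)
    = expect Pi (fun s => \sum_(Q | Q != set0) (Good s == Q)%:R).
  apply: eq_expect => s.
  by have := split_Good (fun _ _ => true) s; under eq_bigr do rewrite andbT; rewrite andbT.
rewrite !expect_sum mulr_sumr; apply: ler_sum => Q /selP selQ.
set q := sel Q in selQ *.
(* The product of the [g true i] is the event that the pattern is [Q]; that of the [g false i] asks
   in addition that trial [q] misses. Both factor over the trials and differ in the factor [q]
   only. *)
pose g b i s := if i == q then good i s && (b || miss i s)
                else (i \in Q) == good i s.
have prod_g b s : ((Good s == Q) && (b || miss q s))%:R = \prod_i (g b i s)%:R :> R.
  rewrite -natr_prod.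
  have -> : (\prod_i g b i s)%N = [forall i, g b i s] :> nat.
    case: (boolP [forall i, _]) => [/forallP gi|].
      by apply: big1 => i _; rewrite gi.
    rewrite negb_forall => /existsP[i /negPf gi].
    by rewrite (bigD1 i)//= gi mul0n.
  congr (nat_of_bool _)%:R; apply/idP/forallP => [/andP[/eqP EQ bm] i|gi].
    rewrite /g -[in i \in Q]EQ inE; case: eqP => [->|_]; last by rewrite eqxx.
    by rewrite bm andbT; move: selQ; rewrite -[in X in X -> _]EQ inE.
  apply/andP; split; last by have := gi q; rewrite /g eqxx => /andP[].
  apply/eqP/setP => i; rewrite inE; have := gi i; rewrite /g.
  by case: eqP => [->|_ /eqP //]; rewrite selQ => /andP[].
have dep_g b i : depends_on (S i) (fun s => (g b i s)%:R : R).
  move=> s s' eq_s; congr (nat_of_bool _)%:R; rewrite /g.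
  by rewrite (dep_good eq_s) (dep_miss eq_s).
have Eg b : expect Pi (fun s => ((Good s == Q) && (b || miss q s))%:R)
    = \prod_i expect Pi (fun s => (g b i s)%:R).
  under eq_expect do rewrite prod_g.
  exact: (expect_indep_prod P predT (dep_g b) disj).
have := Eg false; rewrite /= => ->.
have -> : expect Pi (fun s => (Good s == Q)%:R)
    = expect Pi (fun s => ((Good s == Q) && (true || miss q s))%:R).
  by apply: eq_expect => s; rewrite andbT.
rewrite Eg (bigD1 q)//= [in leRHS](bigD1 q)//= mulrA.
have -> : \prod_(i | i != q) expect Pi (fun s => (g false i s)%:R)
    = \prod_(i | i != q) expect Pi (fun s => (g true i s)%:R).
  by apply: eq_bigr => i /negPf iq; apply: eq_expect => s; rewrite /g iq.
apply: ler_wpM2r.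
  by apply: prodr_ge0 => i _; apply: expect_ge0 => s; rewrite ler0n.
have -> : expect Pi (fun s => (g false q s)%:R)
    = expect Pi (fun s => (good q s && miss q s)%:R).
  by apply: eq_expect => s; rewrite /g eqxx.
have -> : expect Pi (fun s => (g true q s)%:R) = expect Pi (fun s => (good q s)%:R).
  by apply: eq_expect => s; rewrite /g eqxx andbT.
exact: good_miss.
Qed.

End Selection.

(** * Rooted trees *)

Section TreeWalks.
Variable T : rtree.
Implicit Types (u v x y a : T) (p : seq T).

Lemma iter_parent_top k : iter k (@parent T) (top T) = top T.
Proof. by elim: k => //= k ->; rewrite parent_top. Qed.

(** If [v] lay on a cycle of length [k], following it [j] times would return to [v], while [j] steps
    already lead to the top, where [parent] stays. *)
Lemma parent_acyclic v : v != top T -> ~~ fconnect (@parent T) (parent v) v.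
Proof.
apply: contraNN => /iter_findex; rewrite -iterSr.
set k := (findex _ _ _).+1 => loop; have [j jtop] := reach_top v.
have loops i : iter (i * k) (@parent T) v = v.
  by elim: i => // i IHi; rewrite mulSn iterD IHi.
have le_j : (j <= j * k)%N by rewrite leq_pmulr.
by rewrite -[v in v == _](loops j) -(subnK le_j) iterD jtop iter_parent_top.
Qed.

Lemma fconnect_parentE u v :
  fconnect (@parent T) u v = (u == v) || fconnect (@parent T) (parent u) v.
Proof.
apply/idP/orP => [/iter_findex|[/eqP->|]]; last 2 first.
- exact: connect0.
- exact: connect_trans (fconnect1 _ _).
case: (findex _ _ _) => [<-|k <-]; first by left.
by right; rewrite iterSr fconnect_iter.
Qed.

(* Removing edge [v] separates the descendants of [v] from the other nodes. *)
Lemma fconnect_step v x y : v != top T -> adj x y ->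
  fconnect (@parent T) x v (+) fconnect (@parent T) y v
  = ((x, y) == (v, parent v)) || ((x, y) == (parent v, v)).
Proof.
move=> vtop; have step u : parent u != u ->
    fconnect (@parent T) u v (+) fconnect (@parent T) (parent u) v
    = ((u, parent u) == (v, parent v)) || ((u, parent u) == (parent v, v)).
  move=> uu; rewrite fconnect_parentE !xpair_eqE; have [->|uv] := eqVneq u v.
    by rewrite (negPf (parent_acyclic vtop)) eqxx.
  rewrite /= addbb; apply/esym/negbTE/andP => -[/eqP up /eqP pv].
  by have := parent_acyclic vtop; rewrite -up fconnect_parentE pv connect0 orbT.
case/andP=> xy /orP[/eqP yE|/eqP xE].
  by rewrite -yE step// yE eq_sym.
by rewrite -xE addbC step ?xE// orbC !xpair_eqE andbC [X in _ || X]andbC.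
Qed.

Lemma traversals_cons v x y p : traversals v x (y :: p)
  = (((x, y) == (v, parent v)) || ((x, y) == (parent v, v)) + traversals v y p)%N.
Proof. by []. Qed.

Lemma traversals_cat v x p q :
  traversals v x (p ++ q) = (traversals v x p + traversals v (last x p) q)%N.
Proof. by elim: p x => //= y p IHp x; rewrite !traversals_cons IHp addnA. Qed.

(** A step along edge [v] changes the side of that edge, and no other step does. *)
Lemma odd_traversals v x p : v != top T -> path (@adj T) x p ->
  odd (traversals v x p)
  = fconnect (@parent T) x v (+) fconnect (@parent T) (last x p) v.
Proof.
move=> vtop; elim: p x => [|y p IHp] x /=; first by rewrite addbb.
case/andP=> xy py; rewrite traversals_cons oddD IHp// oddb -fconnect_step//.
by rewrite addbA addbK.
Qed.

Lemma traversals_notin v x p z : z \notin x :: p -> z = v \/ z = parent v ->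
  traversals v x p = 0%N.
Proof.
move=> zp zv; elim: p x zp => // y p IHp x; rewrite in_cons negb_or.
case/andP=> zx zp; rewrite traversals_cons IHp// addn0.
move: zx zp; rewrite inE negb_or !xpair_eqE => zx /andP[zy _].
by case: zv => <-; rewrite !(eq_sym _ z) (negPf zx) (negPf zy) ?andbF.
Qed.

Lemma traversals_uniq v x p : uniq (x :: p) -> (traversals v x p <= 1)%N.
Proof.
elim: p x => // y p IHp x; rewrite cons_uniq => /andP[xp yp].
rewrite traversals_cons; case: orP => [xy|_]; last exact: IHp.
rewrite (traversals_notin xp)//.
by case: xy => /eqP[-> _]; [left|right].
Qed.

Lemma on_path_sides v x y : v != top T -> on_path x y v ->
  fconnect (@parent T) x v != fconnect (@parent T) y v.
Proof.
move=> vtop /asboolP[p [pxp <- up tr]].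
have tr1 : traversals v x p = 1%N by apply/eqP; rewrite eqn_leq traversals_uniq.
by rewrite -negb_add negbK -odd_traversals// tr1.
Qed.

(** An edge of a simple path has the two ends on different sides, so by parity every walk between
    them uses it. *)
Lemma on_path_traversals v x p : v != top T -> path (@adj T) x p ->
  on_path x (last x p) v -> (0 < traversals v x p)%N.
Proof.
move=> vtop pxp /(on_path_sides vtop); rewrite lt0n; apply: contra_neq => tr0.
by apply/eqP; rewrite -negb_add -odd_traversals// tr0.
Qed.

Lemma adj_sym : symmetric (@adj T).
Proof. by move=> u v; rewrite /adj eq_sym orbC. Qed.

Lemma connect_adj x y : connect (@adj T) x y.
Proof.
have up z : connect (@adj T) z (top T).
  have [k] := reach_top z; elim: k z => [|k IHk] z; first by move=> /= <-.
  rewrite iterSr => /IHk; have [->//|zz] := eqVneq (parent z) z.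
  by apply: connect_trans; apply: connect1; rewrite /adj eq_sym zz eqxx.
apply: connect_trans (up x) _.
by rewrite (sym_connect_sym adj_sym).
Qed.

Lemma simple_path x y :
  exists p, [/\ path (@adj T) x p, last x p = y & uniq (x :: p)].
Proof.
have /connectP[p pxp ->] := connect_adj x y.
by case/shortenP: pxp => p' pp' up' _; exists p'.
Qed.

Lemma cut_on_path (S : {set T}) x y : (x \in S) != (y \in S) ->
  exists v, [/\ v != top T, (v \in S) != (parent v \in S) & on_path x y v].
Proof.
move=> xyS; have [p [pxp lp up]] := simple_path x y.
have [v [vtop vS tr]] : exists v,
    [/\ v != top T, (v \in S) != (parent v \in S) & (0 < traversals v x p)%N].
  move: xyS; rewrite -lp; elim: p x pxp {lp up} => [|z p IHp] x /=.
    by rewrite eqxx.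
  case/andP=> xz pzp; have [->|xzS] := eqVneq (x \in S) (z \in S).
    move=> /(IHp _ pzp)[v [vtop vS tr]]; exists v; split=> //.
    by rewrite traversals_cons addn_gt0 tr orbT.
  move=> _; case/andP: xz => xz /orP[] /eqP E.
    exists x; rewrite traversals_cons E eqxx; split=> //.
    by apply: contraNneq xz => xtop; rewrite -E xtop parent_top.
  exists z; rewrite traversals_cons E eqxx orbT; split; rewrite // 1?eq_sym//.
  by rewrite eq_sym; apply: contraNneq xz => ztop; rewrite -E ztop parent_top.
by exists v; split=> //; apply/asboolP; exists p.
Qed.

(** A visited node is entered along a traversed edge, and traversed edges belong to [A]; the node is
    the lower end of that edge or its parent, and [A] is closed under parents. *)
Lemma euler_tour_mem (A : {set T}) p v : subtree A -> euler_tour A p ->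
  v != top T -> (v \in p) = (v \in A).
Proof.
move=> [_ subA] [pp lp tr] vtop; apply/idP/idP => [vp|vA]; last first.
  have : (0 < traversals v (top T) p)%N by rewrite tr// vA.
  rewrite lt0n; apply: contraR => vp.
  rewrite (@traversals_notin _ _ _ v)//; last by left.
  by rewrite inE negb_or vtop.
case/splitPr: vp pp lp tr => p1 p2; rewrite cat_path /= => /and3P[_ adjv _] _ tr.
have pos a : a != top T ->
    (last (top T) p1, v) = (a, parent a) \/ (last (top T) p1, v) = (parent a, a) ->
    a \in A.
  move=> atop Ea; have := tr _ atop; rewrite traversals_cat traversals_cons.
  by case: Ea => ->; rewrite eqxx ?orbT; case: (a \in A) => //; rewrite addnCA.
case/andP: adjv => neq /orP[] /eqP E.
  rewrite -E; apply/subA/pos; last by left; rewrite E.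
  by apply: contraNneq neq => u_top; rewrite -E u_top parent_top.
by apply: pos => //; right; rewrite E.
Qed.

End TreeWalks.

(** * The embedding tree with its dummy edges *)

Section EmbeddingTree.
Variables (R : realType) (n : nat) (T : etree R n).
Hypothesis lab_inj : injective (lab T).
Hypothesis lab0 : lab T ord0 = top T.
Hypothesis leavesT : leaves T = [set lab T u | u : 'I_n.+1].

Lemma lab_fac_neq_top i : lab T (fac i) != top T.
Proof. by rewrite -lab0 (inj_eq lab_inj) eq_sym neq_lift. Qed.

Lemma fac_inj : injective (@fac n).
Proof. exact: lift_inj. Qed.

(* A labelled node is a leaf whose single neighbour is its parent. *)
Lemma parent_neq_lab_fac (a : T) i : a != top T -> parent a != lab T (fac i).
Proof.
move=> atop; apply/eqP => pa; set b := lab T (fac i) in pa.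
have btop : b != top T := lab_fac_neq_top i.
have : b \in leaves T by rewrite leavesT imset_f.
rewrite inE => /cards1P[c nb].
have nbP u : adj b u -> u = c by move=> bu; apply/set1P; rewrite -nb inE.
have pb : parent b != b.
  by apply: contraNneq (parent_acyclic btop) => E; rewrite E connect0.
have ab : a != b.
  by apply: contraNneq pb => ab; rewrite -{1}ab pa.
have eq_pb : parent b = c by apply: nbP; rewrite /adj eq_sym pb eqxx.
have eq_a : a = c by apply: nbP; rewrite /adj eq_sym ab pa eqxx orbT.
have := parent_acyclic atop.
by rewrite pa fconnect_parentE eq_pb eq_a connect0 orbT.
Qed.

(** A dummy edge turns each facility leaf into an inner node, and the only other leaf of the
    embedding tree is the root. Hence the GKR guarantee applies with exactly [n] leaves. *)
Lemma leaves_ext : leaves (ext T) :\ top (ext T) = [set inr i | i : 'I_n].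
Proof.
have adj_inl (u v : T) : adj (inl u : ext T) (inl v) = adj u v by [].
have adj_inr (u : T) (i : 'I_n) :
    adj (inl u : ext T) (inr i) = (u == lab T (fac i)) by rewrite /adj eq_sym.
apply/setP => -[a|i]; rewrite !inE; last first.
  rewrite imset_f//=; apply/cards1P; exists (inl (lab T (fac i))).
  apply/setP => -[u|i']; rewrite !inE; last by rewrite /adj /= andbF.
  by rewrite adj_sym adj_inr.
have -> : ((inl a : ext T) \in [set inr i | i : 'I_n]) = false.
  by apply/imsetP => -[].
apply/negP => /andP[atop]; rewrite -[inl a == _]/(a == top T) in atop.
have pa : parent a != a.
  by apply: contraNneq (parent_acyclic atop) => E; rewrite E connect0.
have adj_pa : adj a (parent a) by rewrite /adj eq_sym pa eqxx.
case/cards1P=> c nb.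
have nbP (u : ext T) : adj (inl a : ext T) u -> u = c by move=> au; apply/set1P; rewrite -nb inE.
have cE : c = inl (parent a) by rewrite -(nbP (inl (parent a))).
have : a \in leaves T.
  rewrite inE; apply/cards1P; exists (parent a); apply/setP => u; rewrite !inE.
  apply/idP/eqP => [|->//]; rewrite -adj_inl => /nbP; rewrite cE.
  by move=> [].
rewrite leavesT => /imsetP[u _ au].
case: (unliftP ord0 u) au => [i ->|->] au; last by rewrite au lab0 eqxx in atop.
have /nbP : adj (inl a : ext T) (inr i) by rewrite adj_inr au.
by rewrite cE.
Qed.

Lemma card_leaves_ext : #|leaves (ext T) :\ top (ext T)| = n.
Proof. by rewrite leaves_ext card_imset ?card_ord// => i j []. Qed.

(* [prune], for an arbitrary embedding tree. *)
Definition trim (B : {set ext T}) : {set ext T} :=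
  B :\: [set inl (lab T (fac i)) | i : 'I_n & inr i \notin B].

(** The only child of a facility node is its dummy leaf, so every node removed has no child in
    [B]. *)
Lemma subtree_trim (B : {set ext T}) : subtree B -> subtree (trim B).
Proof.
move=> [topB subB]; split.
  rewrite !inE topB andbT; apply/imsetP => -[i _] [] /eqP.
  by rewrite eq_sym (negPf (lab_fac_neq_top i)).
move=> v; rewrite !inE => /andP[_ vB]; rewrite (subB _ vB) andbT.
apply/imsetP => -[i]; rewrite inE => iB E.
case: v vB E => [a aB [E]|i' i'B [E]]; last first.
  by rewrite -(fac_inj (lab_inj E)) i'B in iB.
have [atop|/(parent_neq_lab_fac i)] := eqVneq a (top T); last by rewrite E eqxx.
by have := lab_fac_neq_top i; rewrite -E atop parent_top eqxx.
Qed.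

Lemma subtree_trim_inl (B : {set ext T}) :
  subtree B -> subtree [set a : T | inl a \in trim B].
Proof.
move=> /subtree_trim[topB subB]; split; first by rewrite inE.
by move=> v; rewrite [v \in _]inE [parent v \in _]inE; exact: (subB (inl v)).
Qed.

Lemma inr_trim (B : {set ext T}) i : (inr i \in trim B) = (inr i \in B).
Proof. by rewrite !inE; case: imsetP => // -[]. Qed.

(** This makes opening a facility the same event as reaching its dummy leaf, the form in which GKR
    speaks of groups. *)
Lemma fac_trim (B : {set ext T}) i : subtree B ->
  (inl (lab T (fac i)) \in trim B) = (inr i \in B).
Proof.
move=> [_ subB]; apply/idP/idP => [|iB].
  rewrite !inE; apply: contraTT => iB; rewrite negb_and negbK.
  by apply/orP; left; apply/imsetP; exists i; rewrite ?inE.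
rewrite !inE (subB (inr i))// andbT; apply/imsetP => -[i'].
by rewrite inE => i'B [] /lab_inj/fac_inj E; rewrite -E iB in i'B.
Qed.

Lemma subtree_bigcup (J : finType) (B : J -> {set ext T}) (j0 : J) :
  (forall j, subtree (B j)) -> subtree (\bigcup_j B j).
Proof.
move=> subB; split; first by apply/bigcupP; exists j0 => //; case: (subB j0).
move=> v /bigcupP[j _ vB]; apply/bigcupP; exists j => //.
by case: (subB j) => _; apply.
Qed.

End EmbeddingTree.

(** * Tours *)

Section FirstOcc.
Variable A : eqType.
Implicit Types s : seq A.

Lemma first_occ_uniq s : uniq (first_occ s).
Proof. by rewrite rev_uniq undup_uniq. Qed.

Lemma mem_first_occ s : first_occ s =i s.
Proof. by move=> x; rewrite mem_rev mem_undup mem_rev. Qed.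

Lemma first_occ_subseq s : subseq (first_occ s) s.
Proof. by rewrite -[s in subseq _ s]revK subseq_rev undup_subseq. Qed.

(** All items of [s1] precede the new items of [s2], so later tours cannot delay a facility already
    reached. *)
Lemma prefix_first_occ_cat s1 s2 x : x \in s1 ->
  subseq (take (index x (first_occ (s1 ++ s2))).+1 (first_occ (s1 ++ s2))) s1.
Proof.
move=> xs1; rewrite {1 2}/first_occ rev_cat undup_cat rev_cat -/(first_occ s1).
have xf : x \in first_occ s1 by rewrite mem_first_occ.
rewrite index_cat xf takel_cat ?index_mem//.
exact: subseq_trans (take_subseq _ _) (first_occ_subseq _).
Qed.

End FirstOcc.

(** * Travel times of walks and tours *)

Section Walks.
Variables (R : realType) (n m : nat) (I : mlufl R n m).

Lemma walk_time_cons u v p :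
  walk_time I u (v :: p) = (time I u v + walk_time I v p)%N.
Proof. by rewrite /walk_time big_cons. Qed.

Lemma walk_time_cat u p q :
  walk_time I u (p ++ q) = (walk_time I u p + walk_time I (last u p) q)%N.
Proof.
elim: p u => [|v p IHp] u /=; first by rewrite /walk_time big_nil.
by rewrite !walk_time_cons IHp addnA.
Qed.

Lemma walk_time_shortcut u v p :
  (walk_time I u p <= time I u v + walk_time I v p)%N.
Proof.
case: p => [|w p]; first by rewrite {1}/walk_time big_nil.
by rewrite !walk_time_cons addnA leq_add2r time_triangle.
Qed.

Lemma walk_time_subseq u p q : subseq p q -> (walk_time I u p <= walk_time I u q)%N.
Proof.
elim: q p u => [|v q IHq] p u; first by rewrite subseq0 => /eqP ->.
case: p => [|w p]; first by rewrite {1}/walk_time big_nil.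
rewrite /=; case: eqP => [->|_] sub.
  by rewrite !walk_time_cons leq_add2l IHq.
rewrite [leqRHS]walk_time_cons; apply: leq_trans (walk_time_shortcut u v _) _.
by rewrite leq_add2l IHq.
Qed.

(** By the triangle inequality, extra returns to the root do not shorten the walk, and they cut it
    into closed tours whose times add up. *)
Lemma walk_time_round_trips (J : Type) (r : seq J) (f : J -> seq 'I_n.+1) :
  (walk_time I ord0 (flatten [seq f j | j <- r])
   <= \sum_(j <- r) walk_time I ord0 (rcons (f j) ord0))%N.
Proof.
apply: (@leq_trans (walk_time I ord0 (flatten [seq rcons (f j) ord0 | j <- r]))).
  apply: walk_time_subseq; elim: r => //= j r IHr.
  by rewrite cat_subseq// subseq_rcons.
elim: r => [|j r IHr] /=; first by rewrite big_nil /walk_time big_nil.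
by rewrite walk_time_cat last_rcons big_cons leq_add2l.
Qed.

Variable T : etree R n.
Hypothesis len_ge0 : forall a : T, 0 <= len a.
Hypothesis dist_ge : forall u v, (time I u v)%:R <= tree_dist T u v.
Hypothesis lab_inj : injective (lab T).

Definition fac_at (a : T) : option 'I_n := [pick i | lab T (fac i) == a].

Lemma fac_atP a i : fac_at a = Some i <-> lab T (fac i) = a.
Proof.
rewrite /fac_at; case: pickP => [i' /eqP <-|no]; last first.
  by split=> // E; have := no i; rewrite E eqxx.
by split=> [[->]//|/lab_inj/lift_inj ->].
Qed.

Lemma time_le_traversals u v p : path (@adj T) (lab T u) p ->
  last (lab T u) p = lab T v ->
  (time I u v)%:R <= \sum_(a : T | a != top T) len a * (traversals a (lab T u) p)%:R.
Proof.
move=> pp lp; apply: le_trans (dist_ge u v) _; apply: ler_sum => a atop.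
rewrite mulrC ler_wpM2l// ler_nat; case: (boolP (on_path _ _ _)) => // onp.
by apply: on_path_traversals; rewrite // lp.
Qed.

(** [p0] holds the tree steps made since [u]. When the walk meets a facility, [p0] pays for the trip
    to it and is emptied, which lets the induction advance one tree node at a time. *)
Lemma walk_time_le_traversals u v p0 p :
  path (@adj T) (lab T u) (p0 ++ p) -> last (lab T u) (p0 ++ p) = lab T v ->
  (walk_time I u (rcons (map fac (pmap fac_at p)) v))%:R
  <= \sum_(a : T | a != top T) len a * (traversals a (lab T u) (p0 ++ p))%:R.
Proof.
elim: p u p0 => [|x p IHp] u p0 /=.
  rewrite cats0 /walk_time big_seq1; exact: time_le_traversals.
rewrite -cat_rcons; case E : (fac_at x) => [i|] /=; last exact: IHp.
move/fac_atP: E => E; rewrite cat_path last_cat last_rcons -E.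
case/andP=> pp0 pp lp; rewrite walk_time_cons natrD.
have := IHp (fac i) [::] pp lp; set s1 := \sum_(a | _) _ => IH.
have := time_le_traversals (v := fac i) pp0; rewrite last_rcons => /(_ erefl) le0.
 apply: le_trans (lerD le0 IH) _; rewrite -big_split/=.
by apply: ler_sum => a _; rewrite -mulrDr traversals_cat natrD last_rcons.
Qed.

Lemma tour_time (B : {set T}) p : lab T ord0 = top T -> euler_tour B p ->
  (walk_time I ord0 (rcons (map fac (first_occ (pmap fac_at p))) ord0))%:R
  <= 2 * \sum_(a | (a != top T) && (a \in B)) len a.
Proof.
move=> lab0 [pp lp tr].
apply: (@le_trans _ _ (walk_time I ord0 (rcons (map fac (pmap fac_at p)) ord0))%:R).
  rewrite ler_nat walk_time_subseq// -!cats1 cat_subseq//.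
  exact/map_subseq/first_occ_subseq.
have := @walk_time_le_traversals ord0 ord0 [::] p; rewrite lab0 => /(_ pp lp) /le_trans.
apply; rewrite mulr_sumr big_mkcondr/=; apply: ler_sum => a atop; rewrite tr//.
by case: (a \in B); rewrite ?muln1 ?muln0 ?mulr0// mulrC.
Qed.

End Walks.

(** * The linear program *)

Section LPFacts.
Variables (R : realType) (n m : nat) (I : mlufl R n m) (T : nat).
Variables (s : lp_point R n m).
Hypothesis lpP : lp_feasible I T s.
Local Notation x := (xvar s).
Local Notation tau := (tau I T s).
Local Notation near := (near I T s).
Local Notation Cstar := (Cstar I T s).

Lemma lp_x_ge0 i j t : (0 < t <= T)%N -> 0 <= x i j t.
Proof. by case: lpP => _ /[apply] -[_ [_ [_ [+ _]]]]. Qed.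

Lemma lp_y_ge0 i t : (0 < t <= T)%N -> 0 <= yvar s i t.
Proof. by case: lpP => _ /[apply] -[_ [_ [_ [_ [+ _]]]]]. Qed.

Lemma lp_z_ge0 e t : (0 < t <= T)%N -> is_edge e -> 0 <= zvar s e t.
Proof. by move=> tT eE; case: lpP => _ /(_ t tT)[_ [_ [_ [_ [_ [z0 _]]]]]]; exact: z0. Qed.

Lemma lp_x_le_y i j t : (0 < t <= T)%N -> x i j t <= yvar s i t.
Proof. by case: lpP => _ /[apply] -[]. Qed.

Lemma lp_travel t : (0 < t <= T)%N ->
  \sum_(e | is_edge e) (time I e.1 e.2)%:R * zvar s e t <= t%:R.
Proof. by case: lpP => _ /[apply] -[_ []]. Qed.

Lemma lp_cut t (S : {set 'I_n}) j : (0 < t <= T)%N ->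
  \sum_(i in S) \sum_(1 <= t' < t.+1) x i j t' <= \sum_(e in delta S) zvar s e t.
Proof. by case: lpP => _ /[apply] -[_ [_ [+ _]]]. Qed.

Definition mass j (t : nat) : R := \sum_(i in near j) \sum_(1 <= t' < t.+1) x i j t'.

Definition latency j : R := \sum_i \sum_(1 <= t < T.+1) t%:R * x i j t.

Lemma x_sum_ge0 (f : nat -> R) i j t : (forall k, 0 <= f k) -> (t <= T)%N ->
  0 <= \sum_(1 <= t' < t.+1) f t' * x i j t'.
Proof.
move=> f0 tT; rewrite big_nat_cond; apply: sumr_ge0 => t'; rewrite andbT ltnS.
by case/andP=> ? ?; rewrite mulr_ge0// lp_x_ge0//; apply/andP; split=> //; lia.
Qed.

Lemma x_sum1_ge0 i j t : (t <= T)%N -> 0 <= \sum_(1 <= t' < t.+1) x i j t'.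
Proof.
move=> tT; have := x_sum_ge0 i j (f := fun=> 1) (fun=> ler01) tT.
by under eq_bigr do rewrite mul1r.
Qed.

Lemma Cstar_ge0 j : 0 <= Cstar j.
Proof.
by apply: sumr_ge0 => i _; apply: (x_sum_ge0 (f := fun=> _)) => // k; exact: ccost_ge0.
Qed.

(** Markov's inequality for connection costs: facilities outside [near j] cost more than
    [4 * Cstar j]. *)
Lemma near_mass j : 3 / 4 <= mass j T.
Proof.
have X0 i : 0 <= \sum_(1 <= t < T.+1) x i j t by exact: x_sum1_ge0.
have [cov _] := lpP; have := cov j.
rewrite (bigID (mem (near j)))/= -/(mass j T); set far := \sum_(i | _) _ => cov_j.
suff : far <= 1 / 4 by lra.
have far0 : 0 <= far by apply: sumr_ge0.
have far_C : 4 * Cstar j * far <= Cstar j.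
  rewrite mulr_sumr /Cstar [leRHS](bigID (mem (near j)))/=.
  rewrite ler_wpDl//; first by apply: sumr_ge0 => i _;
    apply: (x_sum_ge0 (f := fun=> _)) => // k; exact: ccost_ge0.
  apply: ler_sum => i; rewrite inE -ltNge -mulr_sumr => /ltW ?.
  by apply: ler_wpM2r.
(* If [Cstar j] is 0, then [far_C] is void; but then every far facility has positive cost and so
   carries no mass. *)
have := Cstar_ge0 j; rewrite le_eqVlt => /predU1P[C0|Cpos]; last by nra.
suff -> : far = 0 by lra.
rewrite /far big1// => i; rewrite inE -C0 mulr0 -ltNge => c0.
have : \sum_(1 <= t < T.+1) ccost I i j * x i j t = 0.
  apply: (psumr_eq0P (P := predT) (F := fun i => \sum_(1 <= t < T.+1) ccost I i j * x i j t)) => //.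
  move=> i' _; apply: (x_sum_ge0 (f := fun=> _)) => // k; exact: ccost_ge0.
by rewrite -mulr_sumr => /eqP; rewrite mulf_eq0 (gt_eqF c0) => /eqP.
Qed.

Lemma mass_le j t t' : (t <= t')%N -> (t' <= T)%N -> mass j t <= mass j t'.
Proof.
move=> tt t'T; apply: ler_sum => i _.
rewrite [leRHS](big_cat_nat _ (n := t.+1))//= ler_wpDr//.
rewrite big_nat_cond; apply: sumr_ge0 => t1 /andP[/andP[? ?] _].
by rewrite lp_x_ge0//; apply/andP; split; lia.
Qed.

Lemma has_tau j : has (fun t => 2 / 3 <= mass j t) (iota 0 T.+1).
Proof.
apply/hasP; exists T; first by rewrite mem_iota ltnS leqnn.
by have := near_mass j; lra.
Qed.

Lemma tau_le j : (tau j <= T)%N.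
Proof. by have := has_tau j; rewrite has_find size_iota. Qed.

Lemma mass_tau j t : (tau j <= t)%N -> (t <= T)%N -> 2 / 3 <= mass j t.
Proof.
move=> jt tT; apply: le_trans (mass_le j jt tT).
have := nth_find 0%N (has_tau j); rewrite nth_iota ?add0n//.
by have := tau_le j; rewrite ltnS.
Qed.

Lemma mass_lt_tau j t : (t < tau j)%N -> mass j t < 2 / 3.
Proof.
move=> tj; have := before_find 0%N tj; rewrite nth_iota ?add0n//; last first.
  by apply: leq_trans tj _; apply: leqW; exact: tau_le.
by move/negbT; rewrite -ltNge.
Qed.

Lemma tau_gt0 j : (0 < tau j)%N.
Proof.
rewrite lt0n; apply/eqP => tau0; have : 2 / 3 <= mass j 0 by rewrite mass_tau// tau0.
by rewrite /mass big1 ?ltNge => [|i _]; [lra|rewrite big_geq].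
Qed.

Lemma horizon_gt0 : (0 < m)%N -> (0 < T)%N.
Proof. by move=> m0; exact: leq_trans (tau_gt0 (Ordinal m0)) (tau_le _). Qed.

(* A fraction at least 3/4 - 2/3 of client [j] is served from [near j] no earlier
   than at time [tau j]. *)
Lemma tau_latency j : (tau j)%:R <= 12 * latency j.
Proof.
have tj := tau_gt0 j; have jT := tau_le j.
have late : 1 / 12 <= \sum_(i in near j) \sum_(tau j <= t < T.+1) x i j t.
  have : mass j T = mass j (tau j).-1 + \sum_(i in near j) \sum_(tau j <= t < T.+1) x i j t.
    rewrite -big_split; apply: eq_bigr => i _ /=.
    by rewrite prednK// -big_cat_nat//; lia.
  have := near_mass j; have : mass j (tau j).-1 < 2 / 3 by apply: mass_lt_tau; lia.
  lra.
have le_lat : (tau j)%:R * (\sum_(i in near j) \sum_(tau j <= t < T.+1) x i j t) <= latency j.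
  rewrite /latency [leRHS](bigID (mem (near j)))/= ler_wpDr//.
    by apply: sumr_ge0 => i _; apply: (x_sum_ge0 (f := fun t => t%:R)).
  rewrite mulr_sumr; apply: ler_sum => i _.
  rewrite [leRHS](big_cat_nat _ (n := tau j))//=; last by lia.
  rewrite ler_wpDl//.
    rewrite big_nat_cond; apply: sumr_ge0 => t /andP[/andP[? ?] _].
    by rewrite mulr_ge0// lp_x_ge0//; apply/andP; split; lia.
  rewrite mulr_sumr; apply: ler_sum_nat => t /andP[? ?]; rewrite ler_wpM2r ?ler_nat//.
  by rewrite lp_x_ge0//; apply/andP; split; lia.
have : 0 <= (tau j)%:R :> R by [].
nra.
Qed.

Lemma latency_ge0 j : 0 <= latency j.
Proof. by apply: sumr_ge0 => i _; apply: (x_sum_ge0 (f := fun t => t%:R)). Qed.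

Definition opening_cost : R := \sum_i \sum_(1 <= t < T.+1) fcost I i * yvar s i t.

Lemma lp_objectiveE :
  lp_objective I T s = opening_cost + \sum_j (Cstar j + latency j).
Proof.
congr (_ + _); apply: eq_bigr => j _; rewrite -big_split; apply: eq_bigr => i _ /=.
by rewrite -big_split; apply: eq_bigr => t _; rewrite mulrDl.
Qed.

End LPFacts.

(** * The embedding tree of a phase *)

Section Logarithms.
Variable R : realType.

Lemma ceil_nat_ge (a : R) : a <= (ceil_nat a)%:R.
Proof.
rewrite natr_absz; apply: le_trans (Num.Theory.ceil_ge a) _.
by rewrite ler_int ler_norm.
Qed.

Lemma ceil_nat_le (a : R) : 0 <= a -> (ceil_nat a)%:R <= a + 1.
Proof.
move=> a0; rewrite natr_absz ger0_norm; last first.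
  by rewrite Num.Theory.ceil_ge0 (lt_le_trans _ a0)// ltrN10.
by have := Num.Theory.ceilB1_lt a; rewrite intrD => /ltW; lra.
Qed.

Lemma ln2_gt0 : 0 < ln 2 :> R.
Proof. by rewrite ln_gt0// ltr1n. Qed.

Lemma log2_ge1 n : (2 <= n)%N -> 1 <= log2 n%:R :> R.
Proof.
move=> n2; rewrite ler_pdivlMr ?ln2_gt0// mul1r ler_ln ?ler_nat// posrE ?ltr0n//.
lia.
Qed.

Lemma log2M (a b : R) : 0 < a -> 0 < b -> log2 (a * b) = log2 a + log2 b.
Proof. by move=> a0 b0; rewrite /log2 lnM// mulrDl. Qed.

Lemma log2X (a : R) k : 0 < a -> log2 (a ^+ k) = k%:R * log2 a.
Proof. by move=> a0; rewrite /log2 lnXn// -(mulr_natl (ln a)) mulrA. Qed.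

Lemma log2_2 : log2 2 = 1 :> R.
Proof. by rewrite /log2 divff// gt_eqF ?ln2_gt0. Qed.

Lemma log2_le_exp (a : R) k : 0 < a -> (log2 a <= k%:R) = (a <= 2 ^+ k).
Proof.
move=> a0; rewrite ler_pdivrMr ?ln2_gt0// mulr_natl -lnXn ?ltr0n//.
by rewrite ler_ln// posrE exprn_gt0.
Qed.

Lemma log2_le (a b : R) : 0 < a -> a <= b -> log2 a <= log2 b.
Proof.
move=> a0 ab; rewrite ler_pM2r ?invr_gt0 ?ln2_gt0// ler_ln// posrE.
exact: lt_le_trans ab.
Qed.

Lemma log2_nat_le n : log2 n%:R <= n%:R :> R.
Proof.
have [->|n0] := posnP n.
  by rewrite /log2 ln0// mul0r.
by rewrite log2_le_exp ?ltr0n// -natrX ler_nat ltnW// ltn_expl.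
Qed.

End Logarithms.

(** * The values w on one embedding tree *)

Section PhaseTree.
Variables (R : realType) (n m : nat) (I : mlufl R n m) (T : nat).
Variables (s : lp_point R n m) (C : choices R n m) (alpha : R).
Hypotheses (n2 : (2 <= n)%N) (T_gt0 : (0 < T)%N).
Hypothesis lpP : lp_feasible I T s.
Hypothesis CP : choices_spec I alpha C.
Variable l : nat.

Local Notation t := (phase_time T l).
Local Notation Tl := (tree T s C l).
Local Notation logn := (@log2 R n%:R).

Lemma phase_time_itv : (0 < t <= T)%N.
Proof. by rewrite /phase_time leq_min expn_gt0 T_gt0 geq_minr. Qed.

Lemma phase_z_ge0 e : is_edge e -> 0 <= zvar s e t.
Proof. exact: (lp_z_ge0 lpP phase_time_itv). Qed.

Lemma embedding_spec :
  [/\ injective (lab Tl), lab Tl ord0 = top Tl,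
      leaves Tl = [set lab Tl u | u : 'I_n.+1],
      forall a : Tl, 0 <= len a
    & forall u v, (time I u v)%:R <= tree_dist Tl u v].
Proof. by case: CP => /(_ _ phase_z_ge0)[? [? [? [? []]]]]. Qed.

(** Exchanging the sums gives the total tree distance weighted by z, which the embedding compares
    with the travel constraint at time [t]. The maximum keeps the coefficient nonnegative whatever
    the sign of [alpha]. *)
Lemma tree_weight :
  \sum_(a : Tl | a != top Tl) len a * weight (inl a : ext Tl)
  <= Num.max 0 alpha * logn * t%:R.
Proof.
have logn1 := log2_ge1 R n2.
have -> : \sum_(a : Tl | a != top Tl) len a * weight (inl a : ext Tl)
    = \sum_(e | is_edge e) tree_dist Tl e.1 e.2 * zvar s e t.
  under eq_bigr do rewrite mulr_sumr big_mkcondr.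
  rewrite exchange_big; apply: eq_bigr => e _ /=.
  rewrite mulr_suml; apply: eq_bigr => a _.
  by case: (on_path _ _ _); rewrite /= ?mul1r// !mul0r.
case: CP => /(_ _ phase_z_ge0)[_ [_ [_ [_ [_ emb]]]]] _ _ _ _.
apply: le_trans emb _.
have travel0 : 0 <= \sum_(e | is_edge e) (time I e.1 e.2)%:R * zvar s e t.
  by apply: sumr_ge0 => e eE; rewrite mulr_ge0// phase_z_ge0.
apply: (@le_trans _ _ (Num.max 0 alpha * logn
  * \sum_(e | is_edge e) (time I e.1 e.2)%:R * zvar s e t)).
  by rewrite ler_wpM2r// ler_wpM2r ?le_max ?lexx ?orbT//; lra.
rewrite ler_wpM2l ?(lp_travel lpP phase_time_itv)// mulr_ge0 ?le_max ?lexx//.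
by lra.
Qed.

Lemma weight_ge0 (v : ext Tl) : 0 <= weight v.
Proof.
case: v => [a|i] /=; first by apply: sumr_ge0 => e /andP[/phase_z_ge0].
rewrite big_nat_cond; apply: sumr_ge0 => t' /andP[/andP[t'0 t't] _].
apply: (lp_y_ge0 lpP); have /andP[_ tT] := phase_time_itv.
by rewrite t'0 (@leq_trans t).
Qed.

Lemma cut_weight j (S : {set ext Tl}) : (tau I T s j <= t)%N ->
  group I T s C l j \subset S -> top (ext Tl) \notin S ->
  2 / 3 <= \sum_(v | (v != top (ext Tl)) && ((v \in S) != (parent v \in S))) weight v.
Proof.
move=> jt sGS topS; have [lab_inj lab0 _ _ _] := embedding_spec.
have /andP[_ tT] := phase_time_itv.
apply: le_trans (mass_tau lpP jt tT) _.
(* A near facility outside [S'] has its dummy edge cut, whose y-weight dominates its x-mass. Those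
   in [S'] are paid by the LP cut constraint for [S']: each graph edge leaving [S'] has a tree path
   that crosses [S]. *)
pose S' := [set i | (inl (lab Tl (fac i)) : ext Tl) \in S].
rewrite big_sumType /= /mass (bigID (mem S'))/=; apply: lerD; last first.
  rewrite [leRHS]big_mkcond [leLHS]big_mkcond/=; apply: ler_sum => i _.
  rewrite !inE; case: ifP => [/andP[iN iS]|_].
    have -> : inr i \in S.
      by apply: (subsetP sGS); apply/imsetP; exists i; rewrite ?inE.
    rewrite (negPf iS)/=; apply: ler_sum_nat => t' /andP[t'0 t't].
    by apply: (lp_x_le_y lpP); rewrite t'0 (@leq_trans t).
  by case: ifP => // _; exact: (weight_ge0 (inr i)).
apply: (@le_trans _ _ (\sum_(i in S') \sum_(1 <= t' < t.+1) xvar s i j t')).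
  rewrite [leRHS]big_mkcond [leLHS]big_mkcond/=; apply: ler_sum => i _.
  case: (i \in S'); rewrite ?andbT ?andbF//; case: ifP => // _.
  exact: (x_sum1_ge0 lpP).
apply: le_trans (lp_cut lpP S' j phase_time_itv) _.
have labS u : (u \in fac @: S') = (inl (lab Tl u) \in S).
  case: (unliftP ord0 u) => [i ->|->].
    by rewrite (mem_imset _ _ (@lift_inj _ ord0)) inE.
  rewrite lab0 (negPf topS); apply/imsetP => -[i _] /eqP.
  by rewrite (negPf (neq_lift _ _)).
under [leRHS]eq_bigr do rewrite big_mkcondr.
rewrite exchange_big /= /delta big_set/= big_mkcondr; apply: ler_sum => e eE.
case: ifP => [|_]; last first.
  by apply: sumr_ge0 => a _; case: ifP => // _; exact: phase_z_ge0.
rewrite !labS => cutS.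
have [|a [atop aS onp]] := @cut_on_path Tl [set a | inl a \in S] (lab Tl e.1) (lab Tl e.2).
  by rewrite !inE.
rewrite (bigD1 a)/=; last by rewrite -[inl a == _]/(a == top Tl) atop; rewrite !inE in aS.
rewrite onp ler_wpDr//; apply: sumr_ge0 => a' _.
by case: ifP => // _; exact: phase_z_ge0.
Qed.

Lemma gkr_phase :
  [/\ forall A, 0 < gkr_law I T s C l A -> subtree A,
      forall v, v != top (ext Tl) ->
        Pr (gkr_law I T s C l) (fun A => v \in A) <= weight v
    & forall j, (tau I T s j <= t)%N ->
        Pr (gkr_law I T s C l) (fun A => A :&: group I T s C l j == set0)
        <= expR (- (2 / 3 / (64 * logn)))].
Proof.
have [lab_inj lab0 leavesT _ _] := embedding_spec.
have leavesE := leaves_ext lab0 leavesT.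
case: CP => _ /(_ (ext Tl) (groups I T s C l) (@weight _ _ _ _ _ _ _) (fun=> 2 / 3)).
move=> gkrP _ _ _.
have -> : logn = log2 #|leaves (ext Tl) :\ top (ext Tl)|%:R by rewrite card_leaves_ext.
have [] := gkrP.
- by move=> v _; exact: weight_ge0.
- move=> G /imsetP[j _ ->]; rewrite leavesE.
  by apply/subsetP => v /imsetP[i _ ->]; rewrite imset_f.
- by move=> _ _; lra.
- move=> G S /imsetP[j]; rewrite inE => jt -> sGS topS. exact: (cut_weight jt sGS topS).
move=> subA use cover; split=> // j jt; apply: cover.
by apply/imsetP; exists j; rewrite ?inE.
Qed.

End PhaseTree.

(** * The random trees *)

Section Draws.
Variables (R : realType) (n m : nat) (I : mlufl R n m) (T : nat).
Variables (s : lp_point R n m) (C : choices R n m) (alpha : R).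
Hypotheses (n2 : (2 <= n)%N) (m2 : (2 <= m)%N).
Hypothesis lpP : lp_feasible I T s.
Hypothesis CP : choices_spec I alpha C.

Local Notation P := (law I T s C).
Local Notation E := (expect P).
Local Notation logn := (@log2 R n%:R).
Local Notation trees := 'I_(num_trees R m).
Local Notation phases := 'I_(last_phase I T s).+1.

Let T_gt0 : (0 < T)%N.
Proof. by apply: (horizon_gt0 lpP); lia. Qed.

Definition run_pair (r : run I T s) : phases * trees := r.1.

Lemma depends_drawn_tree l q :
  depends_on (fun r => run_pair r == (l, q))
    (fun w : outcome I T s C => drawn_tree w l q).
Proof.
move=> w w' eq_w; congr prune; apply: eq_bigr => k _.
by rewrite eq_w// /run_pair eqxx.
Qed.

Section OneTree.
Variables (l : phases) (q : trees).

Section Cost.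
Variable kappa : forall l : nat, ext (tree T s C l) -> R.
Hypothesis kappa_ge0 : forall (l : nat) (v : ext (tree T s C l)), 0 <= kappa v.
Local Notation budget := (\sum_(v : ext (tree T s C l) | v != top (ext (tree T s C l)))
  kappa v * weight v).
Local Notation spent w := (\sum_(v : ext (tree T s C l) | v != top (ext (tree T s C l)))
  kappa v * (v \in \bigcup_k (w (l, q, k) : {set ext (tree T s C l)}))%:R).

(** One argument for opening costs and lengths; [kappa] is given in all phases because [h] has to be
    defined on every run. The expected spending is at most [192 * logn + 1] budgets, the 1 being due
    to rounding, hence at most [240 * logn], which is 1/32 of the allowance. *)
Lemma overspent : Pr P (fun w => 40 * (192 * logn) * budget < spent w) <= 1 / 32.
Proof.
have logn1 := log2_ge1 R n2.
apply: markov => [w|||]; try lra.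
- by apply: sumr_ge0 => v _; rewrite mulr_ge0.
- apply: mulr_ge0; first lra.
  by apply: sumr_ge0 => v _; rewrite mulr_ge0// (weight_ge0 T_gt0 lpP).
pose h (r : run I T s) (A : {set ext (tree T s C r.1.1)}) : R :=
  \sum_(v | v != top (ext (tree T s C r.1.1))) kappa v * (v \in A)%:R.
have [_ use _] := gkr_phase T_gt0 lpP CP l.
apply: (@le_trans _ _ (E (fun w => \sum_k h (l, q, k) (w (l, q, k))))).
  apply: ler_expect => w _; rewrite /h /= exchange_big/=; apply: ler_sum => v _.
  rewrite -mulr_sumr ler_wpM2l//; case: (boolP (v \in _)) => [/bigcupP[k _ vk]|_].
    by rewrite (bigD1 k)//= vk ler_wpDr// sumr_ge0.
  by rewrite sumr_ge0.
rewrite expect_sum; apply: (@le_trans _ _ (\sum_(k < num_runs R n) budget)).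
  apply: ler_sum => k _.
  rewrite (expect_coord (fun r : run I T s => gkr_law I T s C r.1.1 : fdist R (run_space C r)) h).
  rewrite /h expect_sum; apply: ler_sum => v vtop; rewrite expectZ -Pr_expect.
  by rewrite ler_wpM2l// use.
rewrite sumr_const card_ord -[leLHS]mulr_natl.
have budget0 : 0 <= budget.
  by apply: sumr_ge0 => v _; rewrite mulr_ge0// (weight_ge0 T_gt0 lpP).
have : (num_runs R n)%:R <= 192 * logn + 1 by apply: ceil_nat_le; lra.
by move=> runs; rewrite [leRHS]mulrA ler_wpM2r//; lra.
Qed.

End Cost.

Definition kappa_open (l : nat) (v : ext (tree T s C l)) : R :=
  match v with inl _ => 0 | inr i => fcost I i end.

Definition kappa_len (l : nat) (v : ext (tree T s C l)) : R :=
  match v with inl a => len a | inr _ => 0 end.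

Lemma sum_kappa_open (g : ext (tree T s C l) -> R) :
  \sum_(v | v != top (ext (tree T s C l))) kappa_open v * g v
  = \sum_i fcost I i * g (inr i).
Proof.
rewrite big_sumType/= big1 ?add0r//= => a _; exact: mul0r.
Qed.

Lemma sum_kappa_len (g : ext (tree T s C l) -> R) :
  \sum_(v | v != top (ext (tree T s C l))) kappa_len v * g v
  = \sum_(a | a != top (tree T s C l)) len a * g (inl a).
Proof.
by rewrite big_sumType/= [X in _ + X]big1 ?addr0//= => i _; rewrite mul0r.
Qed.

Lemma mem_drawn_tree (w : outcome I T s C) (v : ext (tree T s C l)) :
  v \in drawn_tree w l q -> v \in \bigcup_k (w (l, q, k) : {set ext (tree T s C l)}).
Proof. by rewrite inE => /andP[]. Qed.

Lemma not_cheap : Pr P (fun w => ~~ cheap I (drawn_tree w l q)) <= 1 / 16.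
Proof.
have logn1 := log2_ge1 R n2.
have [_ _ _ len0 _] := embedding_spec T_gt0 lpP CP l.
have open := @overspent kappa_open; have lens := @overspent kappa_len.
have -> : 1 / 16 = 1 / 32 + 1 / 32 :> R by lra.
apply: le_trans (lerD (open _) (lens _)).
- apply: le_trans (Pr_or _ _ _); apply: ler_Pr => w _ /=.
  rewrite !sum_kappa_open !sum_kappa_len /cheap negb_and -!ltNge.
  case/orP=> over; apply/orP; [left|right]; apply: lt_le_trans over _.
    rewrite big_mkcond; apply: ler_sum => i _; case: ifP => [/mem_drawn_tree ->|_].
      by rewrite mulr1.
    by rewrite mulr_ge0// fcost_ge0.
  rewrite big_mkcondr; apply: ler_sum => a _; case: ifP => [/mem_drawn_tree ->|_].
    by rewrite mulr1.
  by rewrite mulr_ge0.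
- by move=> l' [a|i] //=; exact: fcost_ge0.
- by move=> l' [a|i] //=; have [_ _ _ ->] := embedding_spec T_gt0 lpP CP l'.
Qed.

Lemma cheap_ge : 15 / 16 <= E (fun w => (cheap I (drawn_tree w l q))%:R).
Proof.
rewrite -(Pr_expect P (fun w => cheap I (drawn_tree w l q))).
have := not_cheap.
rewrite (PrC P (fun w => cheap I (drawn_tree w l q))); lra.
Qed.

End OneTree.

(** Stated on the raw GKR draws, before pruning, so that it is a product event over the runs. *)
Definition misses (j : 'I_m) (l : phases) (q : trees) (w : outcome I T s C) : bool :=
  [forall k, (w (l, q, k) : {set ext (tree T s C l)}) :&: group I T s C l j == set0].

Lemma expRN2_le : expR (- 2) <= 15 / 64 :> R.
Proof.
(* The fourth power of this bound is 81/16, which exceeds 64/15. *)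
have half : 3 / 2 <= expR (1 / 2) :> R by have := expR_ge1Dx (1 / 2 : R); lra.
have -> : - 2 = - (4%:R * (1 / 2)) :> R by lra.
rewrite expRN expRM_natl; have : (3 / 2) ^+ 4 <= expR (1 / 2) ^+ 4 :> R.
  by rewrite lerXn2r// nnegrE; lra.
move=> le4; have e0 : 0 < expR (1 / 2) ^+ 4 :> R by rewrite exprn_gt0 ?expR_gt0.
rewrite invf_ple ?posrE//; last lra.
by apply: le_trans le4; lra.
Qed.

Lemma natr_forall (J : finType) (b : J -> bool) :
  [forall k, b k]%:R = \prod_k (b k)%:R :> R.
Proof.
case: (boolP [forall k, _]) => [/forallP bk|].
  by rewrite big1// => k _; rewrite bk.
by rewrite negb_forall => /existsP[k /negPf bk]; rewrite (bigD1 k)//= bk mul0r.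
Qed.

Lemma misses_le j (l : phases) q : (tau I T s j <= phase_time T l)%N ->
  E (fun w => (misses j l q w)%:R) <= 15 / 64.
Proof.
move=> jl; have logn1 := log2_ge1 R n2.
have [_ _ cover] := gkr_phase T_gt0 lpP CP l.
pose h (r : run I T s) (A : {set ext (tree T s C r.1.1)}) : R :=
  (A :&: group I T s C r.1.1 j == set0)%:R.
under eq_expect do rewrite natr_forall.
rewrite (expect_indep_prod (S := fun k => pred1 (l, q, k)) _ predT
           (f := fun k w => h (l, q, k) (w (l, q, k)))); first last.
- by move=> k k' r /eqP -> /eqP [].
- by move=> k w w' eq_w; rewrite eq_w /=.
under eq_bigr => k _.
  rewrite (expect_coord (fun r : run I T s => gkr_law I T s C r.1.1 : fdist R (run_space C r)) h).
  over.
apply: (@le_trans _ _ (\prod_(k < num_runs R n) expR (- (2 / 3 / (64 * logn))))).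
  apply: ler_prod => k _; apply/andP; split; first exact: expect_ge0.
  by rewrite /h -Pr_expect; exact: cover.
rewrite prodr_const card_ord -expRM_natl; apply: le_trans expRN2_le.
rewrite ler_expR mulrN lerN2.
(* Each run contributes [1 / (96 * logn)] to the exponent, and there are at least [192 * logn]
   runs. *)
have : 192 * logn <= (num_runs R n)%:R by exact: ceil_nat_ge.
move=> runs; apply: (@le_trans _ _ (192 * logn * (2 / 3 / (64 * logn)))).
  by have -> : 192 * logn * (2 / 3 / (64 * logn)) = 2 by field; lra.
by rewrite ler_wpM2r// divr_ge0//; lra.
Qed.

Lemma depends_misses j l q : depends_on (fun r => run_pair r == (l, q)) (misses j l q).
Proof.
by move=> w w' eq_w; apply: eq_forallb => k; rewrite eq_w// /run_pair eqxx.
Qed.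

Definition phase_good (l : phases) (w : outcome I T s C) : bool := good_trees w l != set0.

Definition phase_misses j (l : phases) (w : outcome I T s C) : bool :=
  misses j l (select C l (good_trees w l)) w.

Lemma phase_misses_le j (l : phases) : (tau I T s j <= phase_time T l)%N ->
  E (fun w => (phase_good l w && phase_misses j l w)%:R)
  <= 1 / 4 * E (fun w => (phase_good l w)%:R).
Proof.
move=> jl; have [_ _ selP _ _] := CP.
apply: (selection (S := fun q r => run_pair r == (l, q))
  (good := fun q w => cheap I (drawn_tree w l q)) (miss := misses j l)).
- by move=> q w w' /depends_drawn_tree ->.
- by move=> q; exact: depends_misses.
- by move=> q q' r /eqP -> /eqP [].
- exact: selP.
(* The ratio 1/4 arises as 15/64 over 15/16. *)
move=> q; have good := cheap_ge l q; have miss := misses_le q jl.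
have : E (fun w => (cheap I (drawn_tree w l q) && misses j l q w)%:R)
    <= E (fun w => (misses j l q w)%:R).
  by apply: ler_expect => w _; case: (cheap _ _) => //=; rewrite ler0n.
lra.
Qed.

(** A phase fails only if all its trees are too expensive, and 1/16 to the power log2 m is m^-4. *)
Lemma phase_good_ge (l : phases) :
  1 - (m%:R ^+ 4)^-1 <= E (fun w => (phase_good l w)%:R).
Proof.
rewrite -(Pr_expect P (phase_good l)); have : Pr P (predC (phase_good l)) <= (m%:R ^+ 4)^-1.
  rewrite Pr_expect (eq_expect _ (Y := fun w => \prod_q (~~ cheap I (drawn_tree w l q))%:R)).
    rewrite (expect_indep_prod (S := fun q r => run_pair r == (l, q)) _ predT
           (f := fun q w => (~~ cheap I (drawn_tree w l q))%:R)); first last.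
    - by move=> q q' r /eqP -> /eqP [].
    - by move=> q w w' /depends_drawn_tree ->.
    apply: (@le_trans _ _ (\prod_(q < num_trees R m) (1 / 16))).
      apply: ler_prod => q _; rewrite expect_ge0//=.
      by rewrite -(Pr_expect P (fun w => ~~ cheap I (drawn_tree w l q))) not_cheap.
    rewrite prodr_const card_ord expr_div_n expr1n mul1r.
    have m0 : 0 < m%:R :> R by rewrite ltr0n; lia.
    rewrite lef_pV2 ?posrE ?exprn_gt0//.
    have -> : 16 = 2 ^+ 4 :> R by rewrite -natrX.
    rewrite -exprM mulnC exprM; apply: lerXn2r; rewrite ?nnegrE ?exprn_ge0//.
    by rewrite -log2_le_exp// ceil_nat_ge.
  move=> w; rewrite -natr_forall; congr (nat_of_bool _)%:R.
  rewrite /= negbK; apply/eqP/forallP => [g0 q|bad].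
    by have := in_set0 q; rewrite -g0 inE => ->.
  by apply/setP => q; rewrite !inE (negPf (bad q)).
rewrite PrC; lra.
Qed.

Definition all_good (w : outcome I T s C) : bool := [forall l, phase_good l w].

Lemma depends_phase_good l : depends_on (fun r => r.1.1 == l) (phase_good l).
Proof.
move=> w w' eq_w; congr (_ != set0); apply/setP => q; rewrite !inE.
rewrite (@depends_drawn_tree l q w w')// => r /eqP rlq; apply: eq_w.
by rewrite -[r.1](_ : run_pair r = _)// rlq.
Qed.

Lemma depends_phase_misses j l : depends_on (fun r => r.1.1 == l) (phase_misses j l).
Proof.
move=> w w' eq_w; have eq_w' q r : run_pair r == (l, q) -> w r = w' r.
  by move=> /eqP rlq; apply: eq_w; rewrite -[r.1](_ : run_pair r = _)// rlq.
rewrite /phase_misses.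
have -> : good_trees w l = good_trees w' l.
  by apply/setP => q; rewrite !inE (depends_drawn_tree (eq_w' q)).
exact: depends_misses (eq_w' _).
Qed.

Lemma expect_all_good :
  E (fun w => (all_good w)%:R) = \prod_l E (fun w => (phase_good l w)%:R).
Proof.
under eq_expect do rewrite natr_forall.
apply: (expect_indep_prod (S := fun l r => r.1.1 == l) _ predT
           (f := fun l w => (phase_good l w)%:R)).
- by move=> l w w' /depends_phase_good ->.
- by move=> l l' r /eqP -> /eqP.
Qed.

(** Keeping [all_good] inside the expectation, instead of dividing by its probability, lets both
    sides factor over the phases; they are then compared phase by phase. *)
Lemma all_misses_le j (B : {set phases}) :
  (forall l, l \in B -> (tau I T s j <= phase_time T l)%N) ->
  E (fun w => (all_good w && [forall l in B, phase_misses j l w])%:R)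
  <= (1 / 4) ^+ #|B| * E (fun w => (all_good w)%:R).
Proof.
move=> jB; rewrite expect_all_good -prodr_const [X in X * _]big_mkcond -big_split/=.
rewrite (eq_expect _ (Y := fun w =>
   \prod_l (phase_good l w && ((l \in B) ==> phase_misses j l w))%:R)); last first.
  move=> w; rewrite -natr_forall; congr (nat_of_bool _)%:R.
  apply/andP/forallP => [[/forallP g /forallP ms] l|gm]; first by rewrite g ms.
  by split; apply/forallP => l; case/andP: (gm l).
rewrite (expect_indep_prod (S := fun l r => r.1.1 == l) _ predT
   (f := fun l w => (phase_good l w && ((l \in B) ==> phase_misses j l w))%:R)); first last.
- by move=> l l' r /eqP -> /eqP.
- by move=> l w w' eq_w; rewrite (depends_phase_good eq_w) (depends_phase_misses _ eq_w).
apply: ler_prod => l _; rewrite expect_ge0//=; case: ifP => [lB|_].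
  exact/phase_misses_le/jB.
by rewrite mul1r; apply: ler_expect => w _; rewrite andbT.
Qed.

End Draws.

(** * The solution returned *)

Lemma head_filter_ord_min N (p : pred 'I_N.+1) l :
  p l -> (head ord0 (filter p (enum 'I_N.+1)) <= l)%N.
Proof.
move=> pl; have : sorted ltn (map val (filter p (enum 'I_N.+1))).
  apply: (subseq_sorted ltn_trans (s2 := iota 0 N.+1)); last exact: iota_ltn_sorted.
  by rewrite -val_enum_ord map_subseq// filter_subseq.
have : l \in filter p (enum 'I_N.+1) by rewrite mem_filter pl mem_enum.
case: (filter _ _) => // c r; rewrite inE => /predU1P[->//|lr] /=.
move=> /(order_path_min ltn_trans)/allP min_c.
by apply/ltnW/min_c; rewrite map_f.
Qed.

Lemma sum_pow2_le (R : realType) c : \sum_(0 <= k < c.+1) 2 ^+ k <= 2 * 2 ^+ c :> R.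
Proof.
suff : \sum_(0 <= k < c.+1) 2 ^+ k = 2 * 2 ^+ c - 1 :> R by lra.
elim: c => [|c IHc]; first by rewrite big_nat1 expr0; lra.
by rewrite big_nat_recr//= IHc exprS; lra.
Qed.

Lemma sum_take_enum_ord (V : nmodType) N (c : 'I_N) (f : nat -> V) :
  \sum_(l <- take c.+1 (enum 'I_N)) f l = \sum_(0 <= k < c.+1) f k.
Proof.
rewrite -(big_map val predT f) map_take val_enum_ord take_iota.
by rewrite (minn_idPl (ltn_ord c)) /index_iota subn0.
Qed.

Section Outcome.
Variables (R : realType) (n m : nat) (I : mlufl R n m) (T : nat).
Variables (s : lp_point R n m) (C : choices R n m) (alpha : R).
Hypotheses (n2 : (2 <= n)%N) (m2 : (2 <= m)%N).
Hypothesis lpP : lp_feasible I T s.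
Hypothesis CP : choices_spec I alpha C.
Variable w : outcome I T s C.
Hypothesis Pw : 0 < law I T s C w.

Local Notation logn := (@log2 R n%:R).
Local Notation phases := 'I_(last_phase I T s).+1.
Local Notation result := (output w).

Let T_gt0 : (0 < T)%N.
Proof. by apply: (horizon_gt0 lpP); lia. Qed.

Lemma subtree_draw (r : run I T s) : subtree (w r : {set ext (tree T s C r.1.1)}).
Proof.
have [subA _ _] := gkr_phase T_gt0 lpP CP r.1.1.
exact: subA (pmf_coord r Pw).
Qed.

Definition drawn_union (l : phases) q : {set ext (tree T s C l)} :=
  \bigcup_k (w (l, q, k) : {set ext (tree T s C l)}).

Lemma num_runs_gt0 : (0 < num_runs R n)%N.
Proof.
rewrite -(ltr0n R); apply: lt_le_trans (ceil_nat_ge _).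
by have := log2_ge1 R n2; lra.
Qed.

Lemma subtree_drawn_union l q : subtree (drawn_union l q).
Proof.
by apply: (subtree_bigcup (Ordinal num_runs_gt0)) => k; exact: (subtree_draw (l, q, k)).
Qed.

Lemma subtree_phase_tree l : subtree (phase_tree w l).
Proof.
have [lab_inj lab0 leavesT _ _] := embedding_spec T_gt0 lpP CP l.
by apply: (subtree_trim_inl lab_inj lab0 leavesT); exact: subtree_drawn_union.
Qed.

Lemma phase_openedE l i :
  (i \in phase_opened w l) = (inr i \in drawn_union l (select C l (good_trees w l))).
Proof.
have [lab_inj lab0 leavesT _ _] := embedding_spec T_gt0 lpP CP l.
rewrite inE [LHS]inE; apply: (fac_trim lab_inj); exact: subtree_drawn_union.
Qed.

Lemma euler_phase l : euler_tour (phase_tree w l) (tour C (phase_tree w l)).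
Proof. by case: CP => _ _ _ tourP _; exact/tourP/subtree_phase_tree. Qed.

Lemma mem_phase_tour l : phase_tour w l =i phase_opened w l.
Proof.
have [lab_inj lab0 _ _ _] := embedding_spec T_gt0 lpP CP l.
move=> i; rewrite mem_first_occ mem_pmap inE.
rewrite -(euler_tour_mem (subtree_phase_tree l) (euler_phase l)) ?lab_fac_neq_top//.
apply/mapP/idP => [[a ap /esym]|ip].
  by move/(fac_atP lab_inj) => ->.
exists (lab (tree T s C l) (fac i)) => //.
by apply/esym/(fac_atP lab_inj).
Qed.

Lemma connectable_of_hit j (l : phases) : (tau I T s j <= phase_time T l)%N ->
  ~~ connectable w j l -> phase_misses j l w.
Proof.
move=> jl; apply: contraR; rewrite negb_forall => /existsP[k /set0Pn[v]].
rewrite inE => /andP[vw /imsetP[i iN vi]]; apply/set0Pn; exists i.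
rewrite inE iN phase_openedE; apply/bigcupP; exists k => //.
by rewrite -vi.
Qed.

Lemma connectable_first j l : connectable w j l -> (connection_phase w j <= l)%N.
Proof. exact: head_filter_ord_min. Qed.

Hypothesis succ : success w.

Lemma success_good l : cheap I (drawn_tree w l (select C l (good_trees w l))).
Proof.
case: CP => _ _ selP _ _; have /andP[/forallP/(_ l) /(selP l) + _] := succ.
by rewrite inE.
Qed.

Lemma connection_phaseP j : connectable w j (connection_phase w j).
Proof.
have /andP[_ /forallP/(_ j)/existsP[l jl]] := succ; rewrite /connection_phase.
have : l \in filter (connectable w j) (enum phases) by rewrite mem_filter jl mem_enum.
have := filter_all (connectable w j) (enum phases).
by case: (filter _ _) => //= c r /andP[].
Qed.

Lemma assignedP j : assigned result j
  \in near I T s j :&: phase_opened w (connection_phase w j).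
Proof. by case: CP => _ _ _ _; apply; exact: connection_phaseP. Qed.

Lemma feasible_output : feasible result.
Proof.
split; first exact: first_occ_uniq.
  move=> i; rewrite mem_first_occ; apply/flatten_mapP/bigcupP => -[l].
    by move=> _; rewrite mem_phase_tour => il; exists l.
  by move=> _ il; exists l; rewrite ?mem_enum ?mem_phase_tour.
move=> j; apply/bigcupP; exists (connection_phase w j) => //.
by have := assignedP j; rewrite inE => /andP[].
Qed.

Lemma opening_le :
  \sum_(i in opened result) fcost I i
  <= (last_phase I T s).+1%:R * (40 * (192 * logn) * opening_cost I T s).
Proof.
have logn1 := log2_ge1 R n2.
apply: (@le_trans _ _ (\sum_(l : phases) \sum_(i in phase_opened w l) fcost I i)).
  rewrite [leLHS]big_mkcond; under [leRHS]eq_bigr do rewrite big_mkcond.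
  rewrite exchange_big; apply: ler_sum => i _ /=.
  have f0 l : 0 <= (if i \in phase_opened w l then fcost I i else 0).
    by case: ifP => // _; exact: fcost_ge0.
  case: (boolP (i \in _)) => [/bigcupP[l _ il]|_]; last exact: sumr_ge0.
  by rewrite (bigD1 l)//= il ler_wpDr// sumr_ge0.
apply: (@le_trans _ _ (\sum_(l : phases) 40 * (192 * logn) * opening_cost I T s)); last first.
  by rewrite sumr_const card_ord -[leLHS]mulr_natl.
apply: ler_sum => l _; have /andP[open _] := success_good l.
apply: (@le_trans _ _ (\sum_(i | inr i \in drawn_tree w l (select C l (good_trees w l)))
    fcost I i)).
  rewrite le_eqVlt; apply/orP; left; apply/eqP; apply: eq_bigl => i.
  by rewrite phase_openedE; exact/esym/inr_trim.
apply: le_trans open _.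
rewrite ler_wpM2l//; first lra.
apply: ler_sum => i _; rewrite /= -mulr_sumr ler_wpM2l ?fcost_ge0//.
have /andP[_ tT] := phase_time_itv T_gt0 l.
rewrite [leRHS](big_cat_nat _ (n := (phase_time T l).+1))//= ler_wpDr//.
rewrite big_nat_cond; apply: sumr_ge0 => t' /andP[/andP[lt_t' t'T] _].
by apply: (lp_y_ge0 lpP); lia.
Qed.

(** The 4 combines the doubling of tree edges in a tour with the factor 2 lost in summing the powers
    of 2 over the phases. *)
Definition latency_rate : R := 4 * (40 * (192 * logn)) * (Num.max 0 alpha * logn).

Lemma phase_tour_time l :
  (walk_time I ord0 (rcons (map fac (phase_tour w l)) ord0))%:R
  <= latency_rate / 2 * 2 ^+ l.
Proof.
have logn1 := log2_ge1 R n2.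
have [lab_inj lab0 _ len0 dist] := embedding_spec T_gt0 lpP CP l.
apply: le_trans (tour_time len0 dist lab_inj lab0 (euler_phase l)) _.
have /andP[_ lens] := success_good l.
have w_le := tree_weight n2 T_gt0 lpP CP l.
have t_le : (phase_time T l)%:R <= 2 ^+ l :> R.
  by rewrite -natrX ler_nat geq_minl.
have a0 : 0 <= Num.max 0 alpha by rewrite le_max lexx.
have tree_len : \sum_(a | (a != top (tree T s C l)) && (a \in phase_tree w l)) len a
    <= 40 * (192 * logn) * (Num.max 0 alpha * logn * 2 ^+ l).
  apply: le_trans (_ : _ <= 40 * (192 * logn) * (Num.max 0 alpha * logn * (phase_time T l)%:R)) _.
    apply: le_trans (le_trans lens _); last by rewrite ler_wpM2l//; lra.
    rewrite le_eqVlt; apply/orP; left; apply/eqP; apply: eq_bigl => a.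
    by rewrite [a \in phase_tree _ _]inE.
  have c0 : 0 <= 40 * (192 * logn) by lra.
  have b0 : 0 <= Num.max 0 alpha * logn by rewrite mulr_ge0//; lra.
  by rewrite ler_wpM2l// ler_wpM2l.
have -> : latency_rate / 2 * 2 ^+ l
    = 2 * (40 * (192 * logn) * (Num.max 0 alpha * logn * 2 ^+ l)).
  by rewrite /latency_rate; field.
by rewrite ler_wpM2l.
Qed.

Lemma latency_rate_ge0 : 0 <= latency_rate.
Proof.
have logn1 := log2_ge1 R n2.
have a0 : 0 <= Num.max 0 alpha by rewrite le_max lexx.
have b0 : 0 <= Num.max 0 alpha * logn by rewrite mulr_ge0//; lra.
by rewrite mulr_ge0//; lra.
Qed.

(** The assigned facility occurs in the tour of phase [c], so its first occurrence lies within the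
    tours of phases 0 to [c], even if an earlier phase opened it already. *)
Lemma activation_le j :
  (activation I result (assigned result j))%:R
  <= latency_rate * 2 ^+ connection_phase w j.
Proof.
set c := connection_phase w j; set i := assigned result j.
have ic : i \in phase_opened w c by have := assignedP j; rewrite inE => /andP[].
set before := take c.+1 (enum phases).
have ib : i \in flatten [seq phase_tour w l | l <- before].
  apply/flatten_mapP; exists c; last by rewrite mem_phase_tour.
  by rewrite in_take ?mem_enum// index_enum_ord.
have route_split : route result = first_occ (flatten [seq phase_tour w l | l <- before]
    ++ flatten [seq phase_tour w l | l <- drop c.+1 (enum phases)]).
  by rewrite -flatten_cat -map_cat cat_take_drop.
have sub := prefix_first_occ_cat (flatten [seq phase_tour w l | l <- drop c.+1 (enum phases)]) ib.
rewrite /activation route_split.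
apply: le_trans (_ : _ <= (walk_time I ord0
    (flatten [seq map fac (phase_tour w l) | l <- before]))%:R) _.
  rewrite ler_nat; apply: walk_time_subseq.
  have -> : flatten [seq map fac (phase_tour w l) | l <- before]
      = map fac (flatten [seq phase_tour w l | l <- before]).
    by rewrite map_flatten -map_comp.
  exact: map_subseq.
apply: le_trans (_ : _ <= (\sum_(l <- before)
    walk_time I ord0 (rcons (map fac (phase_tour w l)) ord0))%:R) _.
  by rewrite ler_nat walk_time_round_trips.
rewrite natr_sum; apply: le_trans (_ : _ <= \sum_(l <- before) latency_rate / 2 * 2 ^+ l) _.
  by apply: ler_sum => l _; exact: phase_tour_time.
rewrite -mulr_sumr (sum_take_enum_ord c (fun k => 2 ^+ k)).
have := latency_rate_ge0; have := sum_pow2_le R c.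
move: latency_rate (nat_of_ord c) => r N le2 r0.
have -> : r * 2 ^+ N = r / 2 * (2 * 2 ^+ N) by field.
by rewrite ler_wpM2l//; lra.
Qed.

Lemma cost_output_le :
  cost I result <= (last_phase I T s).+1%:R * (40 * (192 * logn) * opening_cost I T s)
    + \sum_j (4 * Cstar I T s j + latency_rate * 2 ^+ connection_phase w j).
Proof.
apply: lerD opening_le _; apply: ler_sum => j _; apply: lerD (activation_le j).
by have := assignedP j; rewrite inE => /andP[]; rewrite inE.
Qed.

End Outcome.

(** * Success probability and expected cost *)

Lemma card_ord_itv N a b : (b <= N)%N -> #|[set l : 'I_N | (a <= l < b)%N]| = (b - a)%N.
Proof.
move=> bN; rewrite -sum1dep_card -(big_mkord (fun l => (a <= l < b)%N) (fun=> 1%N)).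
by rewrite -[RHS]muln1 -sum_nat_const_nat (big_nat_widenl a 0)// (big_nat_widen 0 b N).
Qed.

(* Bounds the part of the expectation of [2 ^ c] due to [c > a] when the tail
   probabilities [P (c > b)] are at most [4 ^- (b + 1 - a)]. *)
Lemma sum_geometric_tail (R : realType) a N :
  \sum_(a <= b < N) 2 ^+ b.+1 * (1 / 4) ^+ (b.+1 - a) <= 2 ^+ a :> R.
Proof.
rewrite -{1}[a]add0n big_addn.
have -> : \sum_(0 <= i < N - a) 2 ^+ (i + a).+1 * (1 / 4) ^+ ((i + a).+1 - a)
    = 2 ^+ a * (1 - (1 / 2) ^+ (N - a)) :> R.
  elim: (N - a)%N => [|M IHM]; first by rewrite big_geq// expr0 subrr mulr0.
  rewrite big_nat_recr//= IHM -addSn addnK exprD.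
  have -> : (1 / 4) ^+ M.+1 = (1 / 2) ^+ M.+1 * (1 / 2) ^+ M.+1 :> R.
    by rewrite -exprMn; congr (_ ^+ _); field.
  have two : 2 ^+ M.+1 * (1 / 2) ^+ M.+1 = 1 :> R.
    by rewrite -exprMn -[RHS](expr1n _ M.+1); congr (_ ^+ _); field.
  set h := (1 / 2) ^+ M.+1 in two *; set t := 2 ^+ M.+1 in two *.
  have -> : t * 2 ^+ a * (h * h) = 2 ^+ a * ((t * h) * h) by ring.
  have hE : (1 / 2) ^+ M = 2 * h :> R by rewrite /h exprS; field.
  by rewrite two hE; ring.
have : 0 <= 2 ^+ a :> R by rewrite exprn_ge0.
have : 0 <= (1 / 2) ^+ (N - a) :> R by rewrite exprn_ge0 ?divr_ge0.
nra.
Qed.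

Section Bounds.
Variables (R : realType) (n m : nat) (I : mlufl R n m) (T : nat).
Variables (s : lp_point R n m) (C : choices R n m) (alpha : R).
Hypotheses (n2 : (2 <= n)%N) (m2 : (2 <= m)%N).
Hypothesis lpP : lp_feasible I T s.
Hypothesis CP : choices_spec I alpha C.

Local Notation P := (law I T s C).
Local Notation E := (expect P).
Local Notation logn := (@log2 R n%:R).
Local Notation logm := (@log2 R m%:R).
Local Notation L := (last_phase I T s).
Local Notation tau := (tau I T s).
Local Notation EG := (E (fun w => (all_good w)%:R)).

Let m_gt0 : 0 < m%:R :> R.
Proof. by rewrite ltr0n ltnW. Qed.

Lemma tau_le_tau_max j : (tau j <= tau_max I T s)%N.
Proof. exact: leq_bigmax. Qed.

Lemma tau_max_gt0 : (0 < tau_max I T s)%N.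
Proof.
exact: leq_trans (tau_gt0 lpP (Ordinal (ltnW m2))) (tau_le_tau_max _).
Qed.

Lemma tau_max_le : (tau_max I T s <= T)%N.
Proof. by apply/bigmax_leqP => j _; exact: tau_le. Qed.

Lemma last_phase_ge : (2 * tau_max I T s * m ^ 4 <= 2 ^ L)%N.
Proof.
rewrite -(ler_nat R) natrM [(m ^ 4)%:R]natrX [(2 ^ L)%:R]natrX natrM.
have t0 : 0 < (tau_max I T s)%:R :> R by rewrite ltr0n tau_max_gt0.
rewrite -log2_le_exp; last by rewrite !mulr_gt0 ?exprn_gt0.
by rewrite log2M ?log2X ?mulr_gt0 ?exprn_gt0//; exact: ceil_nat_ge.
Qed.

(** The logarithms and the rounding give at most [A + 3 + (k + 4) * logm] phases, and [1 <= logm]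
    merges the terms. *)
Lemma last_phase_le A k : (T <= A * m ^ k)%N -> L.+1%:R <= (A + k + 7)%:R * logm.
Proof.
move=> T_le.
have t0 : 0 < (tau_max I T s)%:R :> R by rewrite ltr0n tau_max_gt0.
have logm1 := log2_ge1 R m2.
have A0 : (0 < A)%N.
  have := leq_trans tau_max_gt0 (leq_trans tau_max_le T_le).
  by rewrite muln_gt0 => /andP[].
have log_tau0 : 0 <= log2 (2 * (tau_max I T s)%:R) :> R.
  apply: divr_ge0 (ltW (ln2_gt0 R)); apply: ln_ge0.
  by rewrite -natrM ler1n muln_gt0 tau_max_gt0.
have log_tau : log2 (2 * (tau_max I T s)%:R) <= 1 + A%:R + k%:R * logm :> R.
  apply: (@le_trans _ _ (log2 (2 * (A%:R * m%:R ^+ k)))).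
    rewrite log2_le ?mulr_gt0// ler_wpM2l// -natrX -natrM ler_nat.
    exact: leq_trans tau_max_le T_le.
  rewrite !log2M ?mulr_gt0 ?exprn_gt0 ?ltr0n ?(ltnW m2)// log2_2 log2X// addrA.
  by rewrite lerD2r lerD2l log2_nat_le.
have : L%:R <= log2 (2 * (tau_max I T s)%:R) + 4 * logm + 1 :> R.
  by apply: ceil_nat_le; lra.
rewrite -natr1 !natrD => L_le; have : 0 <= A%:R :> R by [].
nra.
Qed.

(** From this phase on [j] belongs to the groups; truncating phase times at [T] does no harm because
    [tau j <= T]. *)
Definition first_phase j : nat := up_log 2 (tau j).

Lemma first_phase_le j : (2 ^ first_phase j <= 2 * tau j)%N.
Proof.
have := tau_gt0 lpP j; rewrite leq_eqVlt => /predU1P[t1|t1].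
  by rewrite /first_phase -t1 up_log1.
have := up_log_gtn (isT : (1 < 2)%N) t1.
have : (0 < first_phase j)%N by rewrite up_log_gt0.
rewrite /first_phase; case: (up_log _ _) => // e _ lt_e.
by rewrite expnS leq_mul2l ltnW.
Qed.

Lemma first_phaseP j l : (first_phase j <= l)%N -> (tau j <= phase_time T l)%N.
Proof.
move=> jl; rewrite leq_min tau_le// andbT; apply: leq_trans (up_logP (tau j) (isT : (1 < 2)%N)) _.
by rewrite leq_exp2l.
Qed.

(** The term [4 * logm] in the number of phases leaves [j] that many chances after its first one,
    enough to survive a union bound over the clients. *)
Lemma first_phase_last j : (2 ^ first_phase j * m ^ 4 <= 2 ^ L)%N.
Proof.
apply: leq_trans last_phase_ge; rewrite leq_mul2r; apply/orP; right.
apply: leq_trans (first_phase_le j) _.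
by rewrite leq_mul2l tau_le_tau_max.
Qed.

Lemma first_phase_le_last j : (first_phase j <= L)%N.
Proof.
rewrite -(@leq_exp2l 2)//; apply: leq_trans (first_phase_last j).
by rewrite leq_pmulr// expn_gt0; lia.
Qed.

Lemma EG_gt0 : 0 < EG.
Proof.
rewrite (expect_all_good I T s C); apply: prodr_gt0 => l _.
apply: lt_le_trans (phase_good_ge n2 m2 lpP CP l).
rewrite subr_gt0 invf_lt1 ?exprn_gt0// exprn_egt1// ltr1n; lia.
Qed.

Lemma EG_le1 : EG <= 1.
Proof.
rewrite -[leRHS](expect_cst P); apply: ler_expect => w _.
by case: (all_good w); rewrite ?lexx ?ler01.
Qed.

(** A union bound over the phases, with [logm <= m]. The loss is weakened to order 1/m because the
    union bound over the clients concedes as much. *)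
Lemma EG_ge A k : (T <= A * m ^ k)%N -> 1 - (A + k + 7)%:R / m%:R <= EG.
Proof.
move=> T_le.
apply: (@le_trans _ _ (1 - \sum_(l < L.+1) (1 - E (fun w => (phase_good l w)%:R)))).
  rewrite lerB//; apply: (@le_trans _ _ (\sum_(l < L.+1) (m%:R ^+ 4)^-1)).
    by apply: ler_sum => l _; have := phase_good_ge n2 m2 lpP CP l; lra.
  rewrite sumr_const card_ord -[leLHS]mulr_natl.
  apply: (@le_trans _ _ ((A + k + 7)%:R * m%:R * (m%:R ^+ 4)^-1)).
    rewrite ler_wpM2r ?invr_ge0 ?exprn_ge0//; apply: le_trans (last_phase_le T_le) _.
    by rewrite ler_wpM2l ?log2_nat_le.
  rewrite -mulrA ler_wpM2l// exprS invfM mulrA divff ?gt_eqF// mul1r.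
  rewrite lef_pV2 ?posrE ?exprn_gt0// -[leLHS]expr1 ler_eXn2l ?ltr1n//; lia.
have -> : 1 - \sum_(l < L.+1) (1 - E (fun w => (phase_good l w)%:R))
    = E (fun w => 1 - \sum_(l < L.+1) (1 - (phase_good l w)%:R)).
  have lin (X Y : outcome I T s C -> R) : E (fun w => X w - Y w) = E X - E Y.
    rewrite (expect_add P X (fun w => - Y w)); congr (_ + _).
    by rewrite -mulN1r -expectZ; apply: eq_expect => w; rewrite mulN1r.
  rewrite lin expect_cst expect_sum; congr (_ - _); apply: eq_bigr => l _.
  by rewrite lin expect_cst.
apply: ler_expect => w _; case: (boolP (all_good w)) => [/forallP g|].
  by rewrite big1 ?subr0// => l _; rewrite g subrr.
rewrite negb_forall => /existsP[l gl]; rewrite (bigD1 l)//= (negPf gl) subr0.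
have : 0 <= \sum_(i < L.+1 | i != l) (1 - (phase_good i w)%:R : R).
  by apply: sumr_ge0 => i _; case: (phase_good i w); rewrite ?subrr ?subr0.
lra.
Qed.

Lemma unconnected_le j b : (b <= L.+1)%N ->
  E (fun w => (all_good w && [forall l : 'I_L.+1,
      (first_phase j <= l < b)%N ==> ~~ connectable w j l])%:R)
  <= (1 / 4) ^+ (b - first_phase j) * EG.
Proof.
move=> bL; pose B := [set l : 'I_L.+1 | (first_phase j <= l < b)%N].
rewrite -(card_ord_itv (first_phase j) bL).
have BP l : l \in B -> (tau j <= phase_time T l)%N.
  by rewrite inE => /andP[/first_phaseP].
apply: le_trans (all_misses_le n2 m2 lpP CP BP); apply: ler_expect => w Pw.
rewrite ler_nat; case: (all_good w) => //=.
case: forallP => // un; rewrite lt0b; apply/forallP => l; apply/implyP => lB.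
apply: (connectable_of_hit n2 m2 lpP CP Pw (BP l lB)).
by have := un l; rewrite inE in lB; rewrite lB.
Qed.

(** When no phase fails, success is lost only through a client left unconnected in all its eligible
    phases; each of the [m] clients accounts for at most [EG / m ^ 2]. *)
Lemma success_ge_EG : EG * (1 - m%:R^-1) <= Pr P (@success R n m I T s C).
Proof.
rewrite Pr_expect mulrBr mulr1 lerBlDr.
pose un (j : 'I_m) (w : outcome I T s C) := all_good w && [forall l : 'I_L.+1,
      (first_phase j <= l < L.+1)%N ==> ~~ connectable w j l].
apply: (@le_trans _ _ (E (fun w => (success w)%:R + \sum_j (un j w)%:R))).
  apply: ler_expect => w _.
  have un0 : 0 <= \sum_j (un j w)%:R :> R by apply: sumr_ge0.
  rewrite /success -[[forall l, _]]/(all_good w).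
  case: (boolP (all_good w)) => g /=; last by rewrite add0r.
  case: (boolP [forall j, _]) => /= [_|]; first by lra.
  rewrite negb_forall => /existsP[j]; rewrite negb_exists => /forallP nj.
  rewrite (bigD1 j)//= /un g/=.
  have -> : [forall l : 'I_L.+1, (first_phase j <= l < L.+1)%N ==> ~~ connectable w j l].
    by apply/forallP => l; apply/implyP.
  by rewrite add0r lerDl; apply: sumr_ge0.
rewrite expect_add lerD2l expect_sum.
apply: (@le_trans _ _ (\sum_(j < m) (m%:R ^+ 2)^-1 * EG)); last first.
  rewrite sumr_const card_ord -[leLHS]mulr_natl expr2 invfM !mulrA divff ?gt_eqF//.
  by rewrite mul1r mulrC.
apply: ler_sum => j _; apply: le_trans (unconnected_le j (leqnn _)) _.
rewrite ler_wpM2r ?(ltW EG_gt0)//.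
have eL := first_phase_le_last j; rewrite subSn//.
apply: (@le_trans _ _ ((1 / 2) ^+ (L - first_phase j))).
  rewrite exprS; apply: (@le_trans _ _ ((1 / 4) ^+ (L - first_phase j))).
    by rewrite ler_piMl ?exprn_ge0//; lra.
  by apply: lerXn2r; rewrite ?nnegrE; lra.
rewrite expr_div_n expr1n mul1r lef_pV2 ?posrE ?exprn_gt0//.
rewrite -!natrX ler_nat; have := first_phase_last j.
rewrite -{1}(subnK eL) expnD mulnC leq_pmul2r ?expn_gt0//; apply: leq_trans.
by rewrite leq_pexp2l//; lia.
Qed.

Lemma EG_le_success : EG <= 2 * Pr P (@success R n m I T s C).
Proof.
have := success_ge_EG; have := EG_gt0.
have : m%:R^-1 <= 2^-1 :> R by rewrite lef_pV2 ?posrE// ler_nat.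
move=> m_half G0 le_succ.
nra.
Qed.

Lemma connection_phase_le j :
  E (fun w => (all_good w)%:R * 2 ^+ connection_phase w j) <= 4 * (tau j)%:R * EG.
Proof.
set e := first_phase j.
pose un (b : nat) (w : outcome I T s C) := all_good w && [forall l : 'I_L.+1,
      (e <= l < b)%N ==> ~~ connectable w j l].
(* Either the connection phase [c] is at most [e], or [2 ^ c] is the term with [b.+1 = c] of the
   sum, whose event holds because no phase before [c] connects [j]. *)
apply: (@le_trans _ _ (E (fun w => 2 ^+ e * (all_good w)%:R
    + \sum_(e <= b < L.+1) 2 ^+ b.+1 * (un b.+1 w)%:R))).
  apply: ler_expect => w _.
  have sum0 : 0 <= \sum_(e <= b < L.+1) 2 ^+ b.+1 * (un b.+1 w)%:R :> R.
    by apply: sumr_ge0 => b _; rewrite mulr_ge0 ?exprn_ge0.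
  set c := connection_phase w j.
  case g: (all_good w); last by rewrite mul0r mulr0 add0r.
  (* A client that is never connected has the default [c = 0] and falls under the first case. *)
  rewrite mul1r mulr1; have [ce|ec] := leqP c e.
    by rewrite ler_wpDr// ler_weXn2l// ler1n.
  rewrite ler_wpDl ?exprn_ge0//.
  have [c' cE] : exists c', val c = c'.+1 by exists c.-1; rewrite prednK//; lia.
  have cL := ltn_ord c; rewrite /= cE in cL ec *.
  rewrite (big_cat_nat _ (n := c'))//=; last by lia.
  rewrite ler_wpDl//; first by apply: sumr_ge0 => b _; rewrite mulr_ge0 ?exprn_ge0.
  rewrite big_ltn; last by lia.
  have -> : un c'.+1 w.
    rewrite /un g; apply/forallP => l; apply/implyP => /andP[_ lc].
    by apply: contraTN lc => /connectable_first; rewrite -/c cE -leqNgt.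
  rewrite mulr1 lerDl; apply: sumr_ge0 => b _.
  by rewrite mulr_ge0 ?exprn_ge0.
rewrite expect_add expectZ expect_sum.
have e_le : 2 ^+ e <= 2 * (tau j)%:R :> R.
  by rewrite -natrX -natrM ler_nat first_phase_le.
apply: (@le_trans _ _ (2 ^+ e * EG + 2 ^+ e * EG)); last first.
  by have := EG_gt0; nra.
rewrite lerD2l; apply: le_trans (ler_wpM2r (ltW EG_gt0) (sum_geometric_tail R e L.+1)).
rewrite mulr_suml; apply: ler_sum_nat => b /andP[eb bL].
by rewrite expectZ -mulrA ler_wpM2l ?exprn_ge0// unconnected_le.
Qed.

Lemma success_cost_le :
  cond_expect P (@success R n m I T s C) (fun w => cost I (output w))
  <= L.+1%:R * (40 * (192 * logn) * opening_cost I T s)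
     + \sum_j (4 * Cstar I T s j + 96 * latency_rate n alpha * latency T s j).
Proof.
have S0 : 0 < Pr P (@success R n m I T s C).
  by have := EG_le_success; have := EG_gt0; lra.
rewrite ler_pdivrMr//.
set open := L.+1%:R * _; set D := latency_rate n alpha.
have D0 : 0 <= D by exact: latency_rate_ge0.
(* Only the latency term is enlarged from [success] to [all_good], the event on which the tail of
   the connection phase is known. *)
apply: (@le_trans _ _ (E (fun w => (open + \sum_j 4 * Cstar I T s j) * (success w)%:R
    + \sum_j D * ((all_good w)%:R * 2 ^+ connection_phase w j)))).
  rewrite big_mkcond; apply: ler_sum => w _.
  have tail0 : 0 <= \sum_j D * ((all_good w)%:R * 2 ^+ connection_phase w j).
    by apply: sumr_ge0 => j _; apply: mulr_ge0 D0 _; rewrite mulr_ge0 ?exprn_ge0.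
  case: ifP => [succ|_]; last by rewrite mulr0 add0r mulr_ge0// pmf_ge0.
  have := pmf_ge0 P w; rewrite le_eqVlt => /predU1P[<-|Pw]; first by rewrite !mul0r.
  rewrite ler_pM2l// mulr1; apply: le_trans (cost_output_le n2 m2 lpP CP Pw succ) _.
  have -> : all_good w by have /andP[] := succ.
  rewrite -/open -addrA lerD2l big_split/= lerD2l.
  by under [leRHS]eq_bigr do rewrite mul1r.
rewrite expect_add expectZ -Pr_expect expect_sum big_split/= addrA [leRHS]mulrDl lerD2l.
rewrite mulr_suml; apply: ler_sum => j _; rewrite expectZ.
apply: (@le_trans _ _ (D * (4 * (tau j)%:R * EG))).
  by rewrite ler_wpM2l// connection_phase_le.
have tl := tau_latency lpP j; have GS := EG_le_success; have G0 := EG_gt0.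
have t0 : 0 <= (tau j)%:R :> R by [].
(* 96 is the product of the 4 of [connection_phase_le], the 12 of [tau_latency] and the 2 of
   [EG_le_success]. *)
have -> : 96 * D * latency T s j * Pr P (@success R n m I T s C)
   = D * (4 * (12 * latency T s j) * (2 * Pr P (@success R n m I T s C))) by ring.
rewrite ler_wpM2l//; apply: ler_pM => //; first lra.
- lra.
- lra.
Qed.

End Bounds.

Theorem theorem2p6 (R : realType) (alpha : R) (A k : nat) :
  exists (a : nat) (B K : R), (0 < a)%N /\
  forall (n m : nat) (I : mlufl R n m) (T : nat) (s : lp_point R n m)
         (C : choices R n m),
    (2 <= n)%N -> (2 <= m)%N ->
    horizon I T ->
    (T <= A * m ^ k)%N ->
    lp_optimal I T s ->
    choices_spec I alpha C ->
    let P := law I T s C in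
    let succeeds := @success R n m I T s C in
    let result := @output R n m I T s C in
    [/\ 0 < Pr P succeeds,
        1 - B / m%:R ^+ a <= Pr P succeeds,
        forall w, 0 < P w -> succeeds w -> feasible (result w)
      & cond_expect P succeeds (fun w => cost I (result w))
          <= K * (log2 n%:R * Num.max (log2 n%:R) (log2 m%:R)) * lp_objective I T s].
Proof.
pose ph : R := (A + k + 7)%:R; pose al := Num.max 0 alpha.
(* In the failure bound [ph] accounts for failing phases and 1 for unconnected clients. The three
   terms of the last witness pay for openings, connections and latencies. *)
exists 1%N, (ph + 1), (ph * (40 * 192) + 4 + 96 * (4 * (40 * 192) * al)); split=> //.
move=> n m I T s C n2 m2 _ T_le [lpP _] CP P succeeds result.
have al0 : 0 <= al by rewrite le_max lexx.
have ph0 : 0 <= ph by [].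
have GS := EG_le_success n2 m2 lpP CP; have G0 := EG_gt0 n2 m2 lpP CP.
split; first by rewrite /succeeds /P; lra.
- rewrite expr1 mulrDl; have := EG_ge n2 m2 lpP CP T_le.
  have := success_ge_EG n2 m2 lpP CP; have := EG_le1 I T s C.
  have : 0 <= m%:R^-1 :> R by rewrite invr_ge0.
  rewrite -/ph -/P -/succeeds mul1r; set G := expect _ _ => *.
  nra.
- by move=> w Pw succ; exact: (feasible_output n2 m2 lpP CP Pw succ).
apply: le_trans (success_cost_le n2 m2 lpP CP) _.
have logn1 := log2_ge1 R n2; have logm1 := log2_ge1 R m2.
set logn := log2 n%:R in logn1 *; set M := Num.max logn _.
have Mn : logn <= M by rewrite le_max lexx.
have Mm : log2 m%:R <= M by rewrite le_max lexx orbT.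
(* [1 <= X] absorbs the constant 4 of the connection costs, which carry no logarithm. *)
set X := logn * M; have X1 : 1 <= X by rewrite /X; nra.
have nX : logn * logn <= X by rewrite ler_wpM2l//; lra.
have F0 : 0 <= opening_cost I T s.
  apply: sumr_ge0 => i _; rewrite big_nat_cond; apply: sumr_ge0 => t /andP[tT _].
  by rewrite mulr_ge0 ?fcost_ge0// (lp_y_ge0 lpP).
have open_le : (last_phase I T s).+1%:R * (40 * (192 * logn)) <= ph * (40 * 192) * X.
  apply: (@le_trans _ _ (ph * log2 m%:R * (40 * (192 * logn)))).
    by apply: ler_wpM2r; [lra | exact: (last_phase_le m2 lpP T_le)].
  have -> : ph * log2 m%:R * (40 * (192 * logn)) = ph * (40 * 192) * (logn * log2 m%:R) by ring.
  have c1_ge0 : 0 <= ph * (40 * 192) by rewrite !mulr_ge0.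
  apply: ler_wpM2l => //; apply: ler_wpM2l => //; lra.
have latency_le : 96 * latency_rate n alpha <= 96 * (4 * (40 * 192) * al) * X.
  have -> : 96 * latency_rate n alpha = 96 * (4 * (40 * 192) * al) * (logn * logn).
    by rewrite /latency_rate -/logn -/al; ring.
  by rewrite ler_wpM2l// !mulr_ge0.
have : 0 <= ph * (40 * 192) by rewrite !mulr_ge0.
have : 0 <= 96 * (4 * (40 * 192) * al) by rewrite !mulr_ge0.
move: latency_le open_le; set c1 := ph * _; set c3 := 96 * (4 * _ * _).
move: c1 c3 => c1 c3 latency_le open_le c3_ge0 c1_ge0.
have c1X : 0 <= c1 * X by rewrite mulr_ge0//; lra.
have c3X : 0 <= c3 * X by rewrite mulr_ge0//; lra.
have KX : (c1 + 4 + c3) * X = c1 * X + 4 * X + c3 * X by ring.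
rewrite lp_objectiveE [leRHS]mulrDr [X in _ <= _ + X]mulr_sumr; apply: lerD.
  by rewrite mulrA ler_wpM2r// KX; lra.
apply: ler_sum => j _; rewrite mulrDr.
have C0 := Cstar_ge0 lpP j; have L0 := latency_ge0 lpP j.
by apply: lerD; apply: ler_wpM2r => //; rewrite KX; lra.
Qed.
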